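(* Let $p,q\ge 1$ be integers, let $A_1,\dots,A_q,B_1,\dots,B_q$ be $p\times p$ matrices with nonnegative entries, and let $d\in\mathbb{R}_+^p$. Let $(N^{(t)})_{t\in\mathbb{Z}}$ be an i.i.d. sequence of $p$-dimensional count processes such that, for each $t$, every coordinate process $N^{(t)}_1,\dots,N^{(t)}_p$ is a homogeneous Poisson process on $[0,\infty)$ with intensity $1$ (the dependence between the $p$ coordinates being arbitrary). Consider the recursive equations $$Y_t=N^{(t)}_{\lambda_t},\qquad \lambda_t=d+\sum_{i=1}^q A_i\lambda_{t-i}+\sum_{i=1}^q B_iY_{t-i},\qquad t\in\mathbb{Z}, \qquad (\ast)$$ where $Y_t\in\mathbb{N}^p$, $\lambda_t\in\mathbb{R}_+^p$. Then: 1. If $\rho\left(\sum_{i=1}^q(A_i+B_i)\right)<1$, there exists a unique non-anticipative, stationary and integrable solution $(Y_t)_{t\in\mathbb{Z}}$ of $(\ast)$. 2. If $(\ast)$ admits a stationary solution and all the components of $d$ are positive, then $\rho\left(\sum_{i=1}^q(A_i+B_i)\right)<1$. 3. If $\rho\left(\sum_{i=1}^q(A_i+B_i)\right)<1$, then for any $r>1$ the solution in 1. satisfies $\mathbb{E}\left[|Y_t|_1^r\right]<\infty$. 4. If $\rho\left(\sum_{i=1}^q(A_i+B_i)\right)<1$ and, moreover, $\sum_{i=1}^q\left(|A_i|_1+|B_i|_1\right)<1$ or $\left|\sum_{i=1}^q(A_i+B_i)\right|_\infty<1$, then for the solution in 1. there exists $\delta>0$ such that $\mathbb{E}\left[\exp(\delta|Y_0|_1)\right]<\infty$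 and $\mathbb{E}\left[\exp(\delta|\lambda_0|_1)\right]<\infty$.
   Context: $\rho(\cdot)$ denotes the spectral radius of a square matrix. For $x\in\mathbb{R}^p$, $|x|_1=\sum_{i=1}^p|x_i|$. For a $p\times p$ matrix $A$, $|A|_1=\max_{1\le j\le p}\sum_{i=1}^p|A(i,j)|$ and $|A|_\infty=\max_{1\le i\le p}\sum_{j=1}^p|A(i,j)|$ (operator norms associated with the $\ell_1$ and $\ell_\infty$ norms). For $\lambda\in\mathbb{R}_+^p$, $N^{(t)}_\lambda=\left(N^{(t)}_{1,\lambda_1},\dots,N^{(t)}_{p,\lambda_p}\right)'$, i.e. the $i$-th Poisson process evaluated at time $\lambda_i$. A solution is a process $(Y_t,\lambda_t)_{t\in\mathbb{Z}}$ with values in $\mathbb{N}^p\times\mathbb{R}_+^p$, defined on the probability space carrying $(N^{(t)})_{t\in\mathbb{Z}}$ and satisfying the equations almost surely for every $t$; it is stationary if $(Y_t,\lambda_t)_{t\in\mathbb{Z}}$ is (strictly) stationary, non-anticipative if $(Y_t,\lambda_t)$ is measurable with respect to $\sigma(N^{(s)}:s\le t)$ for every $t$, and integrable if $Y_t$ and $\lambda_t$ have finite expectation. Uniqueness is up to almost sure equality. *)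

(* Defs.v *)
From HB Require Import structures.
From mathcomp Require Import all_boot all_order all_algebra.
From mathcomp Require Import finmap.
From mathcomp Require Import all_classical all_reals all_analysis.
From mathcomp Require Import complex.

Set Implicit Arguments.
Unset Strict Implicit.
Unset Printing Implicit Defensive.

Import Order.TTheory GRing.Theory Num.Theory.
Import numFieldNormedType.Exports.

Local Open Scope classical_set_scope.
Local Open Scope ring_scope.

Section MatrixNorms.
Context {R : realType}.

(* The supremum is over a nonempty finite set as soon as 0 < p. *)
Definition spectral_radius p (M : 'M[R]_p) : R :=
  sup [set Normc.normc z
      | z in [set z : complex R | eigenvalue (map_mx (real_complex R) M) z]].

Definition vnorm1 p (x : 'cV[R]_p) : R := \sum_(i < p) `|x i 0|.

Definition mxnorm1 p (M : 'M[R]_p) : R :=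
  \big[Num.max/0]_(j < p) \sum_(i < p) `|M i j|.

Definition mxnormoo p (M : 'M[R]_p) : R :=
  \big[Num.max/0]_(i < p) \sum_(j < p) `|M i j|.

Definition natcol p (y : 'cV[nat]_p) : 'cV[R]_p := map_mx (fun n => n%:R) y.

End MatrixNorms.

Section Processes.
Context {disp : measure_display} {T : measurableType disp} {R : realType}.
Variable P : probability T R.

(* The sigma-algebra on the (arbitrary) set W generated by the maps X k, for
   k in J. *)
Definition sigma_gen W K disp' (S : measurableType disp') (X : K -> W -> S)
    (J : set K) : set (set W) :=
  <<s \bigcup_(k in J) preimage_set_system setT (X k) measurable >>.

Definition independent_family (I : choiceType) (G : I -> set (set T)) : Prop :=
  forall (F : {fset I}) (E : I -> set T), (forall i, i \in F -> G i (E i)) ->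
    P (\bigcap_(i in [set` F]) E i) = (\prod_(i <- F) P (E i))%E.

(* X and X', restricted to the index set J, have the same law on the product
   sigma-algebra, which is generated by the coordinates f |-> f k. *)
Definition same_law K disp' (S : measurableType disp') (X X' : K -> T -> S)
    (J : set K) : Prop :=
  forall C : set (K -> S), sigma_gen (fun k f => f k) J C ->
    P [set w | C (X ^~ w)] = P [set w | C (X' ^~ w)].

(* Only the times u >= 0 matter.  Since paths are nondecreasing, the truncated
   subtraction of nat gives the true increments.  For a nat-valued path,
   right-continuity means being locally constant on the right.  The second
   argument of poisson_prob is a dummy. *)
Record poisson_process (rate : R) (X : R -> T -> nat) : Prop := {
  pp_meas : forall u, 0 <= u -> measurable_fun setT (X u);
  pp_init : forall w, X 0 w = 0%N;
  pp_mono : forall w u v, 0 <= u -> u <= v -> (X u w <= X v w)%N;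
  pp_rcont : forall w u, 0 <= u -> \forall v \near u^'+, X v w = X u w;
  pp_law : forall u v, 0 <= u -> u <= v -> forall B : set nat,
    P ((fun w => (X v w - X u w)%N) @^-1` B) =
    poisson_prob (rate * (v - u)) 0 B;
  pp_indep : forall tau : nat -> R, 0 <= tau 0%N ->
    (forall k, tau k <= tau k.+1) ->
    independent_family (fun k => preimage_set_system setT
      (fun w => (X (tau k.+1) w - X (tau k) w)%N) measurable)
}.

Section Model.
Context {p q : nat}.

(* N t i u w is the value at time u >= 0 of the i-th coordinate of N^(t). *)
Implicit Type N : int -> 'I_p -> R -> T -> nat.

Definition iid_poisson N : Prop :=
  [/\ forall t i, poisson_process 1 (N t i),
      independent_family (fun t => sigma_gen
        (fun k : 'I_p * R => N t k.1 k.2) [set k | 0 <= k.2]) &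
      forall t t', same_law (fun k : 'I_p * R => N t k.1 k.2)
        (fun k => N t' k.1 k.2) [set k | 0 <= k.2]].

Definition past N (t : int) : set (set T) :=
  sigma_gen (fun k : int * ('I_p * R) => N k.1 k.2.1 k.2.2)
    [set k | k.1 <= t /\ 0 <= k.2.2].

Variables (A B : 'I_q -> 'M[R]_p) (d : 'cV[R]_p).
Variable N : int -> 'I_p -> R -> T -> nat.
Variables (Y : int -> T -> 'cV[nat]_p) (lam : int -> T -> 'cV[R]_p).

(* The index i : 'I_q ranges over 0, ..., q-1, hence the lag i.+1. *)
Record is_solution : Prop := {
  sol_measY : forall t i, measurable_fun setT (fun w => Y t w i 0);
  sol_measlam : forall t i, measurable_fun setT (fun w => lam t w i 0);
  sol_ge0 : forall t w i, 0 <= lam t w i 0;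
  sol_Y : forall t, {ae P, forall w,
    Y t w = \col_i N t i (lam t w i 0) w};
  sol_lam : forall t, {ae P, forall w,
    lam t w = d + \sum_(i < q) A i *m lam (t - (i.+1)%:Z) w
                + \sum_(i < q) B i *m natcol (Y (t - (i.+1)%:Z) w)}
}.

Definition coords (k : int * 'I_p) (w : T) : nat * R :=
  (Y k.1 w k.2 0, lam k.1 w k.2 0).

Definition stationary : Prop :=
  forall h : int, same_law (fun k => coords (k.1 + h, k.2)) coords setT.

Definition non_anticipative : Prop :=
  forall t, sigma_gen (fun i => coords (t, i)) setT `<=` past N t.

Definition integrable_process : Prop :=
  forall t i, P.-integrable setT (fun w => ((Y t w i 0)%:R : R)%:E) /\
              P.-integrable setT (fun w => (lam t w i 0)%:E).

Definition good_solution : Prop :=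
  [/\ is_solution, stationary, non_anticipative & integrable_process].

End Model.
End Processes.

(* Main.v *)
From HB Require Import structures.
Require Import Defs.
From mathcomp Require Import all_boot all_order all_algebra.
From mathcomp Require Import finmap.
From mathcomp Require Import all_classical all_reals all_analysis.
From mathcomp Require Import measurable_realfun complex ring lra.

(* Let M be the sum of the A_i + B_i.  The recursion started from zero in the
   remote past is nondecreasing in the starting time and lies below every
   solution; its limit is the candidate stationary solution.  With v a positive
   row vector such that v M <= kappa v, kappa < 1 (resp. a nonnegative one with
   v <= v M <= C v), the Lyapunov function U = sum_i sum_(j <= i) g^(i-j) v (A_i
   lam_(t-j) + B_i Y_(t-j)) satisfies a one-step inequality for E exp(s U):
   for s > 0, g > 1 it gives exponential moments bounded uniformly in the
   starting time, already under rho(M) < 1; for s < 0, g = 1 it gives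
   E exp(- s U) -> 0 as the starting time recedes, which forbids any solution
   when rho(M) >= 1.  Arbitrary dependence between the Poisson coordinates is
   handled by Jensen's inequality.  Uniqueness: any good solution lies above the
   minimal one and both have mean (1 - M)^-1 d. *)

Set Implicit Arguments.
Unset Strict Implicit.
Unset Printing Implicit Defensive.

Import Order.TTheory GRing.Theory Num.Theory.
Import numFieldNormedType.Exports.

Local Open Scope classical_set_scope.
Local Open Scope ring_scope.

(** * Nonnegative matrices *)

(** A reducible nonnegative matrix may have no positive Perron vector, so eigenvectors give way to
    strict inequalities [v M < v] with [v] positive, obtained from resolvents. The probabilistic
    part rests on one fact: for an intensity known from the past, a Poisson count enters an
    exponential moment through [psi p x], which equals x up to order x^2 near 0. Below criticality
    the slack 1 - kappa absorbs this error for all small s. From criticality on there may be no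
    slack: each step costs order s^2, so the exponent has to decrease like 1/n along the recursion;
    the gain, v d times the sum of the exponents, is then a harmonic sum and still diverges. The
    other obstacle is the passage to the limit: the intensities of the histories approach their
    limit from below while Poisson paths are only right-continuous, so the limiting count could miss
    a jump. Comparing expectations excludes this almost surely. *)

Section NonnegativeMatrices.
Context {R : realType}.

Definition mxle m n (X Y : 'M[R]_(m, n)) : Prop := forall i j, X i j <= Y i j.

Lemma mxle_refl m n (X : 'M[R]_(m, n)) : mxle X X.
Proof. by move=> i j. Qed.

Lemma mxle_trans m n (X Y Z : 'M[R]_(m, n)) : mxle X Y -> mxle Y Z -> mxle X Z.
Proof. by move=> XY YZ i j; exact: le_trans (XY i j) (YZ i j). Qed.

Lemma mxle_add m n (X X' Y Y' : 'M[R]_(m, n)) :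
  mxle X Y -> mxle X' Y' -> mxle (X + X') (Y + Y').
Proof. by move=> h h' i j; rewrite !mxE lerD. Qed.

Lemma mxle_sum m n (I : finType) (F G : I -> 'M[R]_(m, n)) :
  (forall k, mxle (F k) (G k)) -> mxle (\sum_k F k) (\sum_k G k).
Proof. by move=> h i j; rewrite !summxE ler_sum// => k _; exact: h. Qed.

Lemma mxge0_sum m n (I : finType) (F : I -> 'M[R]_(m, n)) :
  (forall k, mxle 0 (F k)) -> mxle 0 (\sum_k F k).
Proof.
by move=> h i j; rewrite mxE summxE sumr_ge0// => k _; have := h k i j; rewrite mxE.
Qed.

Lemma mxle_mull m n k (X Y : 'M[R]_(m, n)) (Z : 'M[R]_(n, k)) :
  mxle 0 Z -> mxle X Y -> mxle (X *m Z) (Y *m Z).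
Proof.
move=> Z0 XY i j; rewrite !mxE ler_sum// => l _.
by rewrite ler_wpM2r//; have := Z0 l j; rewrite mxE.
Qed.

Lemma mxle_mulr m n k (X Y : 'M[R]_(n, k)) (Z : 'M[R]_(m, n)) :
  mxle 0 Z -> mxle X Y -> mxle (Z *m X) (Z *m Y).
Proof.
move=> Z0 XY i j; rewrite !mxE ler_sum// => l _.
by rewrite ler_wpM2l//; have := Z0 i l; rewrite mxE.
Qed.

Lemma mxge0_mul m n k (X : 'M[R]_(m, n)) (Y : 'M[R]_(n, k)) :
  mxle 0 X -> mxle 0 Y -> mxle 0 (X *m Y).
Proof. by move=> X0 Y0; have := mxle_mulr X0 Y0; rewrite mulmx0. Qed.

Lemma mxge0P m n (X : 'M[R]_(m, n)) : mxle 0 X <-> forall i j, 0 <= X i j.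
Proof. by split=> h i j; have := h i j; rewrite mxE. Qed.

Lemma mxge0E m n (X : 'M[R]_(m, n)) i j : mxle 0 X -> 0 <= X i j.
Proof. by move/mxge0P. Qed.

Variables (p : nat) (M : 'M[R]_p).
Hypothesis M0 : mxle 0 M.

(** The working form of a spectral radius below r, see [spectral_radius_lt1P] for r = 1. Row
    vectors, because they get paired with the column state. *)
Definition subinvariant (r : R) (w : 'rV[R]_p) : Prop :=
  (forall j, 0 < w 0 j) /\ forall j, (w *m M) 0 j < r * w 0 j.

(** A maximum principle: the negative part [z] of [y] satisfies r z <= M z, and pairing with [w]
    gives r w z <= w M z < r w z unless z = 0. *)
Lemma subinvariant_comparison r w (y : 'cV[R]_p) : subinvariant r w ->
  mxle (M *m y) (r *: y) -> mxle 0 y.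
Proof.
move=> [w0 wM] hy; apply/mxge0P => i0 j0; rewrite (ord1 j0) leNgt; apply/negP => yi0.
pose z : 'cV[R]_p := \col_i Num.max (- y i 0) 0.
have z0 : mxle 0 z by apply/mxge0P => i j; rewrite mxE le_max lexx orbT.
have zy : mxle (- y) z by move=> i j; rewrite !mxE (ord1 j) le_max lexx.
have hz : mxle (r *: z) (M *m z).
  move=> i j; rewrite (ord1 j) [X in X <= _]mxE [z i 0]mxE.
  have [yi|yi] := leP (- y i 0) 0.
    by rewrite mulr0; have /mxge0P := mxge0_mul M0 z0.
  have := mxle_mulr M0 zy i 0; apply: le_trans.
  by rewrite mulmxN mxE mulrN lerN2; have := hy i 0; rewrite [X in _ <= X]mxE.
have := mxle_mulr _ hz 0 0.
move=> /(_ _ w); have wge0 : mxle 0 w by apply/mxge0P => i j; rewrite (ord1 i) ltW.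
move=> /(_ wge0); rewrite mulmxA; apply/negP; rewrite -ltNge.
rewrite -scalemxAr 3!mxE mulr_sumr.
apply: (@lt_le_trans _ _ (\sum_j r * w 0 j * z j 0)); last first.
  by rewrite ler_sum// => j _; rewrite mulrA.
rewrite (bigD1 i0)//= [ltRHS](bigD1 i0)//=; apply: ltr_leD.
  by rewrite ltr_pM2r// mxE lt_max oppr_gt0 yi0.
by apply: ler_sum => j _; apply: ler_wpM2r; [exact: mxge0E|exact/ltW].
Qed.

(** A kernel vector and its opposite both satisfy the comparison, hence vanish. A column y of the
    inverse satisfies it because r y - M y is a basis vector. *)
Lemma subinvariant_unit r w : subinvariant r w ->
  r%:M - M \in unitmx /\ mxle 0 (invmx (r%:M - M)).
Proof.
move=> rw.
have unitG : r%:M - M \in unitmx.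
  rewrite -unitmx_tr -row_free_unit; apply: inj_row_free => v vG0.
  have Gv : (r%:M - M) *m v^T = 0 by rewrite -[_ - _]trmxK -trmx_mul vG0 trmx0.
  have Mv : M *m v^T = r *: v^T.
    by move/eqP: Gv; rewrite mulmxBl mul_scalar_mx subr_eq0 => /eqP.
  have v0 : mxle 0 v^T by apply: (subinvariant_comparison rw); rewrite Mv; exact: mxle_refl.
  have v0' : mxle 0 (- v^T).
    by apply: (subinvariant_comparison rw); rewrite mulmxN Mv scalerN; exact: mxle_refl.
  apply/rowP => j; apply/eqP; rewrite eq_le.
  by move: (v0 j 0) (v0' j 0); rewrite !mxE oppr_ge0 => -> ->.
split=> // i j; rewrite mxE.
suff /mxge0P/(_ i 0) : mxle 0 (col j (invmx (r%:M - M))) by rewrite mxE.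
apply: (subinvariant_comparison rw) => k l; rewrite -subr_ge0.
have : ((r%:M - M) *m col j (invmx (r%:M - M))) k l = (k == j)%:R.
  by rewrite colE mulmxA mulmxV// mul1mx mxE (ord1 l) eqxx andbT.
by rewrite mulmxBl mul_scalar_mx mxE [X in _ + X = _]mxE => ->; rewrite ler0n.
Qed.

Lemma subinvariant_large : exists2 r, 0 < r & subinvariant r (const_mx 1).
Proof.
exists (1 + \sum_i \sum_j M i j).
  by rewrite ltr_pwDl// sumr_ge0// => i _; rewrite sumr_ge0// => j _; exact: mxge0E.
split=> j; first by rewrite mxE.
rewrite !mxE mulr1 ltr_pwDl// ler_sum// => i _.
rewrite mxE mul1r (bigD1 j)//= lerDl sumr_ge0// => k _; exact: mxge0E.
Qed.

Lemma subinvariant_up r s w : r <= s -> subinvariant r w -> subinvariant s w.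
Proof.
move=> rs [w0 wM]; split=> // j; apply: (lt_le_trans (wM j)).
by rewrite ler_wpM2r// ltW.
Qed.

(* With r0 the infimum of the r admitting a positive subinvariant vector, the
   resolvent is nonnegative on ]r0, +oo[; if r0 is not an eigenvalue then, by
   continuity, it is also nonnegative at r0, and its column sums provide a
   subinvariant vector for some r < r0. *)
Lemma subinvariant_exists : (forall r : R, 1 <= r -> ~~ eigenvalue M r) ->
  exists w, subinvariant 1 w.
Proof.
move=> noeig; pose S := [set r : R | 0 < r /\ exists w, subinvariant r w].
have S0 : S !=set0.
  by have [r r0 rS] := subinvariant_large; exists r; split=> //; exists (const_mx 1).
have Slb : has_lbound S by exists 0 => r [/ltW].

pose r0 := inf S.
have Sup r : r0 < r -> exists w, subinvariant r w.
  move=> r0r; have [s [_ [w sw]] sr] := inf_lt S0 r0r.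
  by exists w; apply: subinvariant_up sw; exact: ltW.
have [r01|r01] := ltP r0 1; first exact: Sup.
have detE r : \det (r%:M - M) = (char_poly M).[r].
  rewrite /char_poly -horner_evalE -det_map_mx; congr (\det _).
  apply/matrixP => i j; rewrite !mxE /= horner_evalE.
  by case: eqP => _; rewrite !hornerE.
have adjE r i j : \adj (r%:M - M) i j = (\adj (char_poly_mx M) i j).[r].
  rewrite mxE [in RHS]mxE /cofactor hornerM -signr_odd horner_exp !hornerE signr_odd.
  congr (_ * _); rewrite -horner_evalE -det_map_mx; congr (\det _).
  apply/matrixP => k l; rewrite !mxE /= horner_evalE.
  by case: eqP => _; rewrite !hornerE.
have unit0 : r0%:M - M \in unitmx.
  by rewrite unitmxE unitfE detE -/(root _ _) -eigenvalue_root_char noeig.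
(* At r this is det^2 times the entry of the inverse: a polynomial in r with the sign of that entry,
   so nonnegativity passes to the limit at [r0] whatever the sign of the determinant. *)
pose q i j := char_poly M * \adj (char_poly_mx M) i j.
have qE r i j : (q i j).[r] = \det (r%:M - M) * \adj (r%:M - M) i j.
  by rewrite hornerM detE adjE.
have q_gt r i j : r0 < r -> 0 <= (q i j).[r].
  move=> /Sup[w /subinvariant_unit[uG /mxge0P/(_ i j)]].
  rewrite /invmx uG mxE qE => h; have := mulr_ge0 (sqr_ge0 (\det (r%:M - M))) h.
  by rewrite mulrA expr2 mulfK// -unitfE -unitmxE.
have q0 i j : 0 <= (q i j).[r0].
  have h : (q i j).[x] @[x --> r0^'+] --> (q i j).[r0].
    by apply: cvg_at_right_filter; exact: continuous_horner.
  rewrite -(cvg_lim _ h)//; apply: limr_ge; first by apply/cvg_ex; eexists; exact: h.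
  by near=> x; apply: q_gt; near: x; exact: nbhs_right_gt.
have inv0 : mxle 0 (invmx (r0%:M - M)).
  apply/mxge0P => i j; rewrite /invmx unit0 mxE.
  have d0 : \det (r0%:M - M) != 0 by rewrite -unitfE -unitmxE.
  have := mulr_ge0 (sqr_ge0 (\det (r0%:M - M))^-1) (q0 i j).
  by rewrite qE mulrA expr2 mulfVK.
(* The column sums of the resolvent satisfy r0 w = 1 + w M. The gap 1 survives lowering [r0] by [e]
   because e w_j < 1; the 2 in [e] gives e < 1, so that r0 - e stays positive. *)
pose w : 'rV[R]_p := const_mx 1 *m invmx (r0%:M - M).
have wE j : r0 * w 0 j = 1 + (w *m M) 0 j.
  have : r0 *: w - w *m M = const_mx 1 by rewrite -mul_mx_scalar -mulmxBr mulmxKV.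
  move=> /matrixP/(_ 0 j); rewrite [LHS]mxE [RHS]mxE.
  by rewrite [X in X + _]mxE [X in _ + X]mxE => /eqP; rewrite subr_eq => /eqP.
have wge0 : mxle 0 w by apply: mxge0_mul => // i j; rewrite !mxE ler01.
have wM0 j : 0 <= (w *m M) 0 j by apply/mxge0E/mxge0_mul.
have wgt0 j : 0 < w 0 j.
  have : 0 < r0 * w 0 j by rewrite wE ltr_pwDl.
  by rewrite pmulr_rgt0// (lt_le_trans ltr01).
pose e := (2 + \sum_j w 0 j)^-1.
have sw0 : 0 <= \sum_j w 0 j by rewrite sumr_ge0// => j _; rewrite ltW.
have d0 : 0 < 2 + \sum_j w 0 j by lra.
have e0 : 0 < e by rewrite invr_gt0.
have e1 : e < 1 by rewrite invf_lt1//; lra.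
have : S (r0 - e).
  split; first lra.
  exists w; split=> // j; rewrite mulrBl wE.
  have : e * w 0 j < 1.
    rewrite mulrC ltr_pdivrMr// mul1r (bigD1 j)//=.
    have : 0 <= \sum_(i < p | i != j) w 0 i by rewrite sumr_ge0// => i _; rewrite ltW.
    lra.
  lra.
by move=> /(ge_inf Slb); rewrite -/r0; lra.
Unshelve. all: by end_near.
Qed.

Lemma subinvariant_contraction w : subinvariant 1 w ->
  exists kappa, [/\ 0 < kappa, kappa < 1 & mxle (w *m M) (kappa *: w)].
Proof.
move=> [w0 wM].
(* The default value keeps the constant positive even when [w *m M] vanishes. *)
pose k := \big[Num.max/2^-1]_j ((w *m M) 0 j / w 0 j).
have k0 : 2^-1 <= k by apply: bigmax_ge_id.
exists k; split.
- by apply: lt_le_trans k0; rewrite invr_gt0.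
- apply/bigmax_ltP; split=> [|j _]; first by rewrite invf_lt1// ltr1n.
  by rewrite ltr_pdivrMr// wM.
- move=> i j; rewrite (ord1 i) [leRHS]mxE -ler_pdivrMr//.
  exact: le_bigmax.
Qed.

(** The moduli u of a left eigenvector satisfy |z| u <= u M; pairing with [c] gives |z| u c <= u M c
    <= k u c, where u c > 0. *)
Lemma eigenvalue_bound k (c : 'cV[R]_p) : (forall i, 0 < c i 0) ->
  mxle (M *m c) (k *: c) -> forall z : complex R,
  eigenvalue (map_mx (real_complex R) M) z -> Normc.normc z <= k.
Proof.
move=> c0 Mc z /eigenvalueP[v vz v0].
have [j0 vj0] : exists j, v 0 j != 0.
  by apply/existsP; rewrite -[[exists _, _]]negbK negb_exists; apply: contra v0 =>
    /forallP h; apply/eqP/rowP => j; rewrite mxE; apply/eqP; have := h j; rewrite negbK.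
pose u : 'rV[R]_p := \row_j Normc.normc (v 0 j).
have nsum (F : 'I_p -> complex R) :
    Normc.normc (\sum_i F i) <= \sum_i Normc.normc (F i).
  elim/big_ind2 : _ => [|x x' y y' hx hy|//]; first by rewrite Normc.normc0.
  exact: le_trans (le_normcD _ _) (lerD hx hy).
have n0 (x : complex R) : 0 <= Normc.normc x.
  by case: x => a b /=; rewrite sqrtr_ge0.
have nr (a : R) : 0 <= a -> Normc.normc (real_complex R a) = a.
  by move=> a0; rewrite /= expr0n addr0 sqrtr_sqr ger0_norm.
have uM : mxle (Normc.normc z *: u) (u *m M).
  move=> i j; rewrite (ord1 i) !mxE -Normc.normcM.
  have := congr1 (fun A : 'rV[complex R]_p => A 0 j) vz; rewrite [RHS]mxE => <-.
  rewrite mxE; apply: (le_trans (nsum _)); apply: ler_sum => l _.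
  by rewrite Normc.normcM !mxE nr//; exact: mxge0E.
have u0 : mxle 0 u by move=> i j; rewrite !mxE.
have c0' : mxle 0 c by move=> i j; rewrite (ord1 j) mxE ltW.
have h : mxle (Normc.normc z *: (u *m c)) (k *: (u *m c)).
  rewrite [X in mxle X _]scalemxAl; apply: (@mxle_trans _ _ _ (u *m M *m c)); first exact: mxle_mull.
  by rewrite -mulmxA scalemxAr; exact: mxle_mulr.
have := h 0 0; rewrite [leLHS]mxE [leRHS]mxE ler_pM2r//.
rewrite mxE (bigD1 j0)//=; apply: ltr_pwDl.
  by rewrite mulr_gt0// mxE lt_def n0 andbT; apply: contra vj0 => /eqP/Normc.eq0_normc ->.
by rewrite sumr_ge0// => j _; rewrite mulr_ge0 ?mxge0E.
Qed.

(** [eigenvalue] is about left eigenvectors, so bounding the spectrum takes a right vector. The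
    choice c = (1 - M)^-1 1 works since M c = c - 1. *)
Lemma subinvariant_col w : subinvariant 1 w -> exists c : 'cV[R]_p,
  (forall i, 0 < c i 0) /\ exists2 k, k < 1 & mxle (M *m c) (k *: c).
Proof.
move=> /subinvariant_unit[uG G0]; set G := invmx _ in G0.
pose c : 'cV[R]_p := G *m const_mx 1.
have c0 : mxle 0 c by apply: mxge0_mul => // i j; rewrite !mxE ler01.
have Mc0 : mxle 0 (M *m c) by exact: mxge0_mul.
have cE i : c i 0 = 1 + (M *m c) i 0.
  have : c - M *m c = const_mx 1.
    by rewrite -[X in X - _]mul1mx -mulmxBl mulKVmx.
  move=> /matrixP/(_ i 0); rewrite [LHS]mxE [RHS]mxE [X in _ + X]mxE => /eqP.
  by rewrite subr_eq => /eqP.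
have cgt0 i : 0 < c i 0 by rewrite cE ltr_pwDl// mxge0E.
exists c; split=> //.
pose k := \big[Num.max/0]_i ((M *m c) i 0 / c i 0).
exists k; last first.
  move=> i j; rewrite (ord1 j) [leRHS]mxE -ler_pdivrMr//.
  exact: le_bigmax.
apply/bigmax_ltP; split=> [|i _]; first by [].
by rewrite ltr_pdivrMr// mul1r [ltRHS]cE ltrDr.
Qed.

(** From left to right it suffices to exclude real eigenvalues r >= 1: this is the Perron-Frobenius
    content of [subinvariant_exists]. Boundedness of the spectrum, required to use the supremum,
    comes from the constant vector. *)
Lemma spectral_radius_lt1P : (0 < p)%N ->
  spectral_radius M < 1 <-> exists w, subinvariant 1 w.
Proof.
move=> p0; rewrite /spectral_radius; set S := [set _ | _ in _]; split; last first.
  move=> [w /subinvariant_col[c [c0 [k k1 Mc]]]].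
  have [->|/set0P S0] := eqVneq S set0; first by rewrite sup0.
  apply: le_lt_trans k1; apply: ge_sup => // _ [z /= hz <-].
  exact: eigenvalue_bound Mc _ hz.
move=> rho1; apply: subinvariant_exists => r r1; apply/negP => eigr.
suff : r <= sup S by apply/negP; rewrite -ltNge (lt_le_trans rho1).
apply: ub_le_sup.
  pose k := \sum_i \sum_j M i j; exists k => _ [z /= hz <-].
  apply: (@eigenvalue_bound _ (const_mx 1)) hz => [i|i j]; first by rewrite mxE.
  rewrite !mxE mulr1 /k [leRHS](bigD1 i)//= ler_wpDr//.
    by rewrite sumr_ge0// => l _; rewrite sumr_ge0// => m _; exact: mxge0E.
  by apply: ler_sum => l _; rewrite mxE mulr1.
exists (real_complex R r); first by rewrite /= eigenvalue_map.
by rewrite /= expr0n addr0 sqrtr_sqr ger0_norm// (le_trans _ r1).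
Qed.

(* The resolvent at a large r makes the modulus of a left eigenvector
   comparable with its image by M. *)
Lemma superinvariant_exists : (forall w, ~ subinvariant 1 w) ->
  exists v : 'rV[R]_p, [/\ mxle 0 v, v != 0, mxle v (v *m M) &
    exists2 C, 0 < C & mxle (v *m M) (C *: v)].
Proof.
move=> nosub.
have [r r1 /eigenvalueP[x xr x0]] : exists2 r : R, 1 <= r & eigenvalue M r.
  apply: contrapT => h; have [|w /nosub//] := subinvariant_exists.
  by move=> r r1; apply/negP => er; apply: h; exists r.
pose u : 'rV[R]_p := \row_j `|x 0 j|.
have u0 : mxle 0 u by move=> i j; rewrite !mxE.
have uM : mxle u (u *m M).
  move=> i j; rewrite (ord1 i); apply: (@le_trans _ _ (r * u 0 j)).
    by rewrite ler_peMl// mxge0E.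
  have -> : r * u 0 j = `|(x *m M) 0 j|.
    by rewrite xr !mxE normrM (ger0_norm (le_trans ler01 r1)).
  rewrite !mxE.
  apply: (le_trans (ler_norm_sum _ _ _)); apply: ler_sum => l _.
  by rewrite normrM !mxE (ger0_norm (mxge0E _ _ M0)).
have [C C0 /subinvariant_unit[uG G0]] := subinvariant_large.
(* [u] may vanish where u M does not, and then no C gives u M <= C u. The vector v = u (C - M)^-1
   has v M = C v - u <= C v, and it inherits u <= u M because the resolvent commutes with M. *)
set G := invmx _ in G0; pose v := u *m G.
have v0 : mxle 0 v by exact: mxge0_mul.
have vE : v *m M = C *: v - u.
  have : v *m (C%:M - M) = u by rewrite mulmxKV.
  rewrite mulmxBr mul_mx_scalar => <-; by rewrite opprB addrC subrK.
exists v; split=> //.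
- apply/eqP => vz; move: vE; rewrite vz mul0mx scaler0 sub0r => /eqP.
  rewrite eq_sym oppr_eq0 => /eqP uz; move/eqP: x0; apply; apply/rowP => j.
  by have := congr1 (fun A : 'rV[R]_p => A 0 j) uz; rewrite !mxE => /eqP;
    rewrite normr_eq0 => /eqP.
- have GM : G *m M = M *m G.
    have h : (C%:M - M) *m M = M *m (C%:M - M).
      by rewrite mulmxBl mulmxBr mul_scalar_mx mul_mx_scalar.
    by rewrite -[in LHS](mulmxK uG M) -h !mulmxA mulVmx// mul1mx.
  by rewrite /v -mulmxA GM mulmxA; exact: mxle_mull.
- exists C => // i j; rewrite vE mxE [X in _ + X]mxE lerBlDr lerDl.
  exact: mxge0E.
Qed.

End NonnegativeMatrices.

(** * Independence *)

Section Independence.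
Context {disp : measure_display} {T : measurableType disp} {R : realType}.
Variable P : probability T R.

Section Cylinders.
Context {U : Type} {I : choiceType} (G : I -> set (set U)).
Hypotheses (GT : forall i, G i setT) (GI : forall i, setI_closed (G i)).

Definition cylinders (J : set I) : set (set U) :=
  [set C | exists (F : {fset I}) (E : I -> set U), [/\ [set` F] `<=` J,
     (forall i, G i (E i)) & C = \bigcap_(i in [set` F]) E i]].

Lemma cylinders_setI J : setI_closed (cylinders J).
Proof.
move=> _ _ [F [E [FJ GE ->]]] [F' [E' [FJ' GE' ->]]].
exists (F `|` F')%fset, (fun i => (if i \in F then E i else setT) `&`
   (if i \in F' then E' i else setT)); split.
- by move=> i /=; rewrite inE => /orP[/FJ|/FJ'].
- by move=> i; apply: GI; case: ifP.
apply/seteqP; split=> [w [wE wE'] i /= iF|w h].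
  by split; case: ifPn => // h; [apply: wE|apply: wE'].
split=> i /= iF.
  by have := h i; rewrite /= inE iF /= => /(_ isT)[].
by have := h i; rewrite /= inE iF orbT => /(_ isT)[].
Qed.

Lemma cylindersT J : cylinders J setT.
Proof.
exists fset0, (fun=> setT); split=> //; last by rewrite set_fset0 bigcap_set0.
Qed.

Lemma cylinders_gen J : \bigcup_(i in J) G i `<=` cylinders J.
Proof.
move=> C [i Ji GC]; exists [fset i]%fset, (fun j => if j == i then C else setT).
split=> [j /=|j|]; first by rewrite inE => /eqP ->.
  by case: eqP => // ->.
by rewrite set_fset1 bigcap_set1 eqxx.
Qed.

End Cylinders.

(** As functions of C, the intersection probability and the product are two finite measures that
    agree on the cylinders, a pi-system. Agreement there is independence with [E] added as one more
    factor, at the index [t] outside [J]. *)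
Lemma independent_sigma (I : choiceType) (G : I -> set (set T)) (J : set I) t :
  (forall i, G i `<=` measurable) -> (forall i, G i setT) ->
  (forall i, setI_closed (G i)) -> independent_family P G -> ~ J t ->
  forall C E, <<s \bigcup_(i in J) G i >> C -> G t E ->
    P (C `&` E) = (P C * P E)%E.
Proof.
move=> Gm GT GI Gind Jt C E sC GE; have mE := Gm _ _ GE.
have PE : P E \is a fin_num by exact: fin_num_measure.
have PE0 : 0 <= fine (P E) by rewrite fine_ge0.
pose m1 := mrestr P mE; pose m2 := mscale (NngNum PE0) P.
have m1E A : m1 A = P (A `&` E) by [].
have m2E A : m2 A = (P A * P E)%E by rewrite /m2 /mscale /= fineK// muleC.
suff : m1 C = m2 C by rewrite m1E m2E.
have cylm : cylinders G J `<=` measurable.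
  move=> _ [F [E' [_ GE' ->]]]; apply: fin_bigcap_measurable => // i _.
  exact/Gm/GE'.
apply: (g_sigma_algebra_measure_unique (cylinders G J) cylm (fun=> setT)).
- by move=> _; exact: cylindersT.
- by rewrite bigcup_const.
- exact: cylinders_setI.
- move=> _ [F [E' [FJ GE' ->]]]; rewrite [LHS]m1E [RHS]m2E.
  have tF : t \notin F by apply/negP => tF; apply/Jt/FJ.
  have -> : P (\bigcap_(i in [set` F]) E' i) = (\prod_(i <- F) P (E' i))%E.
    by apply: Gind => i _; exact: GE'.
  pose E'' i := if i == t then E else E' i.
  have -> : \bigcap_(i in [set` F]) E' i `&` E = \bigcap_(i in [set` (t |` F)%fset]) E'' i.
    apply/seteqP; split=> [w [h wE] i /=|w h].
      by rewrite !inE /E''; case: eqP => //= _; exact: h.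
    split=> [i /= iF|].
      have := h i; rewrite /= !inE iF orbT /E'' => /(_ isT).
      by case: eqP => // it; rewrite it (negbTE tF) in iF.
    by have := h t; rewrite /= !inE eqxx /E'' eqxx; exact.
  rewrite Gind; last by move=> i _; rewrite /E''; case: eqP => // ->.
  rewrite big_fsetU1//= {1}/E'' eqxx muleC; congr (_ * _)%E.
  apply: eq_big_seq => i iF; rewrite /E''; case: eqP => // it.
  by rewrite it (negbTE tF) in iF.
- by move=> _; rewrite [ltLHS]m1E setTI ltey_eq PE.
- move: C sC; apply: sub_smallest2r; first exact: smallest_sigma_algebra.
  exact: cylinders_gen.
Qed.


Definition as_mfun d d' (T1 : measurableType d) (T2 : measurableType d')
    (f : T1 -> T2) (mf : measurable_fun setT f) : {mfun T1 >-> T2} :=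
  HB.pack f (isMeasurableFun.Build _ _ _ _ f mf).

(** Lets a sigma-algebra act as a random variable: two copies of the identity, into the past and
    into the present, form the independent pair to which Fubini is applied. *)
Lemma measurable_id_sub (H : set (set T)) : H `<=` measurable ->
  measurable_fun setT (id : T -> g_sigma_algebraType H).
Proof.
move=> Hm; apply: (@measurability _ _ T (g_sigma_algebraType H) setT id H) => // _ [A HA <-].
by rewrite setTI; exact: Hm.
Qed.

(** Independence identifies the joint law with the product of the marginal laws, where Tonelli
    applies. *)
Lemma fubini_independent d1 d2 (T1 : measurableType d1) (T2 : measurableType d2)
    (X1 : T -> T1) (X2 : T -> T2) (f : T1 * T2 -> \bar R) :
  measurable_fun setT X1 -> measurable_fun setT X2 ->
  (forall C E, measurable C -> measurable E ->
    P (X1 @^-1` C `&` X2 @^-1` E) = (P (X1 @^-1` C) * P (X2 @^-1` E))%E) ->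
  measurable_fun setT f -> (forall x, (0 <= f x)%E) ->
  (\int[P]_w f (X1 w, X2 w) = \int[P]_w \int[P]_w' f (X1 w, X2 w'))%E.
Proof.
move=> mX1 mX2 ind mf f0; pose i1 := as_mfun mX1; pose i2 := as_mfun mX2.
pose dg := as_mfun (measurable_fun_pair mX1 mX2).
have prodE X : measurable X ->
    (distribution P i1 \x distribution P i2)%E X = distribution P dg X.
  by apply: product_measure_unique => C E mC mE; exact: ind.
transitivity (\int[distribution P dg]_x f x)%E.
  by rewrite ge0_integral_distribution.
transitivity (\int[(distribution P i1 \x distribution P i2)%E]_x f x)%E.
  by apply: eq_measure_integral => X mX _; exact/esym/prodE.
rewrite fubini_tonelli1// /fubini_F ge0_integral_distribution//=; last 2 first.
- exact: measurable_fun_fubini_tonelli_F.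
- by move=> x; exact: integral_ge0.
apply: eq_integral => w _; rewrite ge0_integral_distribution//.
exact: measurableT_comp.
Qed.

(** Stands in for conditional expectation: a bound valid for each frozen value of the first variable
    holds for the random one. *)
Lemma fubini_independent_le d1 d2 (T1 : measurableType d1) (T2 : measurableType d2)
    (X1 : T -> T1) (X2 : T -> T2) (f : T1 * T2 -> \bar R) (g : T1 -> \bar R) :
  measurable_fun setT X1 -> measurable_fun setT X2 ->
  (forall C E, measurable C -> measurable E ->
    P (X1 @^-1` C `&` X2 @^-1` E) = (P (X1 @^-1` C) * P (X2 @^-1` E))%E) ->
  measurable_fun setT f -> (forall x, (0 <= f x)%E) -> measurable_fun setT g ->
  (forall x, (\int[P]_w f (x, X2 w) <= g x)%E) ->
  (\int[P]_w f (X1 w, X2 w) <= \int[P]_w g (X1 w))%E.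
Proof.
move=> mX1 mX2 ind mf f0 mg fg; rewrite (fubini_independent mX1 mX2 ind mf f0).
apply: ge0_le_integral => //.
- by move=> w _; exact: integral_ge0.
- have -> : (fun w => \int[P]_w' f (X1 w, X2 w'))%E =
      fubini_F (distribution P (as_mfun mX2)) f \o X1.
    apply/funext => w; rewrite /= /fubini_F ge0_integral_distribution//.
    exact: measurableT_comp.
  by apply: measurableT_comp => //; exact: measurable_fun_fubini_tonelli_F.
- exact: measurableT_comp.
Qed.

Lemma law_unique (U : pointedType) (G : set (set U)) (X X' : T -> U) :
  setI_closed G -> G setT ->
  (forall A, G A -> [/\ measurable (X @^-1` A), measurable (X' @^-1` A) &
                       P (X @^-1` A) = P (X' @^-1` A)]) ->
  forall A, <<s G >> A -> P (X @^-1` A) = P (X' @^-1` A).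
Proof.
move=> GI GT GX.
have mX : measurable_fun setT (X : T -> g_sigma_algebraType G).
  by apply: (@measurability _ _ T (g_sigma_algebraType G) setT _ G) => // _ [A /GX[mA _ _] <-]; rewrite setTI.
have mX' : measurable_fun setT (X' : T -> g_sigma_algebraType G).
  by apply: (@measurability _ _ T (g_sigma_algebraType G) setT _ G) => // _ [A /GX[_ mA _] <-]; rewrite setTI.
move=> A sA.
rewrite -[LHS]/(distribution P (as_mfun mX) A) -[RHS]/(distribution P (as_mfun mX') A).
apply: (@measure_unique _ R (g_sigma_algebraType G) G (fun=> setT) erefl GI _ _
    (distribution P (as_mfun mX)) (distribution P (as_mfun mX'))) => //.
- by rewrite bigcup_const.
- by move=> B /GX[].
- by move=> _; rewrite [ltLHS]probability_setT ltry.
Qed.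

End Independence.

Lemma preimage_g_sigma (W U : Type) (f : W -> U) (G : set (set U)) (H : set (set W)) :
  (forall A, G A -> <<s H >> (f @^-1` A)) ->
  forall D, <<s G >> D -> <<s H >> (f @^-1` D).
Proof.
move=> GH; apply: smallest_sub => [|A /GH//]; split.
- by rewrite preimage_set0; exact: sigma_algebra0.
- move=> A hA; rewrite setTD preimage_setC -setTD.
  exact: (@sigma_algebraCD _ setT H).
- move=> F hF; rewrite preimage_bigcup; exact: sigma_algebra_bigcup.
Qed.

Lemma sigma_gen_preimage K W disp (S : measurableType disp) (X : K -> W -> S)
    (J : set K) D :
  sigma_gen (fun k (f : K -> S) => f k) J D -> sigma_gen X J [set w | D (X ^~ w)].
Proof.
apply: (@preimage_g_sigma W (K -> S) (fun w k => X k w)) => A [k Jk [B mB <-]].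
by apply: sub_sigma_algebra; exists k => //; exists B.
Qed.

(** * The noise: past, present and invariance under time shifts *)

Section PoissonFamilies.
Context {disp : measure_display} {T : measurableType disp} {R : realType}.
Variable P : probability T R.
Context {p : nat}.
Variable N : int -> 'I_p -> R -> T -> nat.
Hypothesis hN : iid_poisson P N.

Definition past_gen (t : int) : set (set T) :=
  \bigcup_(k in [set k : int * ('I_p * R) | k.1 <= t /\ 0 <= k.2.2])
    preimage_set_system setT (N k.1 k.2.1 k.2.2) measurable.

Definition present_gen (t : int) : set (set T) :=
  \bigcup_(k in [set k : 'I_p * R | 0 <= k.2])
    preimage_set_system setT (N t k.1 k.2) measurable.

Lemma iid_measurable t i u : 0 <= u -> measurable_fun setT (N t i u).
Proof. by move=> u0; case: hN => /(_ t i)[mN _ _ _ _ _] _ _; exact: mN. Qed.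

Lemma past_gen_measurable t : past_gen t `<=` measurable.
Proof.
move=> _ [[s [i u]] /= [_ u0] [B mB <-]]; exact: iid_measurable.
Qed.

Lemma present_gen_measurable t : present_gen t `<=` measurable.
Proof. by move=> _ [[i u] /= u0 [B mB <-]]; exact: iid_measurable. Qed.

Lemma present_measurable t : <<s present_gen t >> `<=` measurable.
Proof.
apply: smallest_sub; first exact: sigma_algebra_measurable.
exact: present_gen_measurable.
Qed.

Lemma past_independent t C E : <<s past_gen (t - 1) >> C -> <<s present_gen t >> E ->
  P (C `&` E) = (P C * P E)%E.
Proof.
move=> hC hE; pose G s : set (set T) := <<s present_gen s >>.
have [_ Gind _] := hN.
apply: (@independent_sigma _ _ _ P _ G [set s | s <= t - 1] t) => //.
- by move=> s; exact: present_measurable.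
- by move=> s; exact: (@measurableT _ (g_sigma_algebraType (present_gen s))).
- by move=> s; exact: (@measurableI _ (g_sigma_algebraType (present_gen s))).
- by rewrite /= lerBrDl gerDr ler10.
- move: C hC; apply: sub_sigma_algebra2 => C [[s [i u]] /= [st u0] [B mB <-]].
  exists s => //; apply: sub_sigma_algebra; exists (i, u) => //.
  by exists B.
Qed.

(** Equality of the one-time laws and independence give equal probabilities to finite products of
    one-time events, and these form a generating pi-system. *)
Lemma path_law_shift (h : int) (D : set (int * ('I_p * R) -> nat)) :
  sigma_gen (fun k f => f k) [set k | 0 <= k.2.2] D ->
  P [set w | D (fun k => N k.1 k.2.1 k.2.2 w)] =
  P [set w | D (fun k => N (k.1 + h) k.2.1 k.2.2 w)].
Proof.
move=> sD; pose C0 : set (set ('I_p * R -> nat)) :=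
  sigma_gen (fun k f => f k) [set k | 0 <= k.2].
pose slice (s : int) (f : int * ('I_p * R) -> nat) : 'I_p * R -> nat :=
  fun k => f (s, k).
pose G (s : int) := preimage_set_system setT (slice s) C0.
have C0T : C0 setT by exact: (@measurableT _ (g_sigma_algebraType _)).
have GT s : G s setT by exists setT => //; rewrite setTI.
have GI s : setI_closed (G s).
  move=> _ _ [A A0 <-] [B B0 <-]; exists (A `&` B); last by rewrite !setTI.
  exact: (@measurableI _ (g_sigma_algebraType _)).
have slice_sigma s A : C0 A -> <<s present_gen s >> [set w | A (fun k => N s k.1 k.2 w)].
  by move=> hA; exact: (@sigma_gen_preimage _ _ _ _ (fun k => N s k.1 k.2)).
have [_ Nind Nlaw] := hN.
apply: (@law_unique _ _ _ P _ (cylinders G setT)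
  (fun w k => N k.1 k.2.1 k.2.2 w) (fun w k => N (k.1 + h) k.2.1 k.2.2 w)).
- exact: cylinders_setI.
- exact: cylindersT.
- move=> _ [F [E [_ GE ->]]].
  pose A (s : int) := sval (cid2 (GE s)).
  have A0 s : C0 (A s) by rewrite /A; case: cid2.
  have AE s f : E s f <-> A s (slice s f).
    by rewrite /A; case: cid2 => /= B _ <-; split=> [[]|].
  pose B1 s := [set w | A s (fun k => N s k.1 k.2 w)].
  pose B2 s := [set w | A (s - h) (fun k => N s k.1 k.2 w)].
  have -> : (fun w k => N k.1 k.2.1 k.2.2 w) @^-1` (\bigcap_(i in [set` F]) E i) =
      \bigcap_(s in [set` F]) B1 s.
    apply/seteqP; split=> w hw s sF.
      by apply/(AE s (fun k => N k.1 k.2.1 k.2.2 w)); exact: hw.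
    by apply/(AE s (fun k => N k.1 k.2.1 k.2.2 w)); exact: hw.
  have -> : (fun w k => N (k.1 + h) k.2.1 k.2.2 w) @^-1` (\bigcap_(i in [set` F]) E i) =
      \bigcap_(s in [set` [fset (s + h)%R | s in F]%fset]) B2 s.
    apply/seteqP; split=> w hw s.
      move=> /= /imfsetP[r /= rF ->]; rewrite /B2/= addrK.
      by apply/(AE r (fun k => N (k.1 + h) k.2.1 k.2.2 w)); exact: hw.
    move=> sF; apply/(AE s (fun k => N (k.1 + h) k.2.1 k.2.2 w)).
    have := hw (s + h); rewrite /B2 /= addrK; apply.
    by apply/imfsetP; exists s.
  have m1 : measurable (\bigcap_(s in [set` F]) B1 s).
    by apply: fin_bigcap_measurable => // s _; apply: present_measurable; exact: slice_sigma.
  have m2 : measurable (\bigcap_(s in [set` [fset (s + h)%R | s in F]%fset]) B2 s).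
    by apply: fin_bigcap_measurable => // s _; apply: present_measurable; exact: slice_sigma.
  split=> //.
  rewrite !Nind; [|by move=> s _; exact: slice_sigma|by move=> s _; exact: slice_sigma].
  rewrite big_imfset/=; last by move=> x y _ _ /addIr.
  apply: eq_bigr => s _; rewrite /B1 /B2 addrK.
  exact: (Nlaw s (s + h) (A s) (A0 s)).
- move: D sD; apply: sub_sigma_algebra2 => A [[s [i u]] /= u0 [B mB <-]].
  apply: cylinders_gen => //; exists s => //.
  exists [set f | B (f (i, u))]; last by rewrite !setTI.
  apply: sub_sigma_algebra; exists (i, u) => //; exists B => //.
  by rewrite setTI.
Qed.

End PoissonFamilies.

(** * Poisson processes at random times *)

Section RightContinuousEvaluation.
Context {R : realType}.

(** For u >= 0, the least multiple of 1/(k+1) strictly above [u]. Strictness matches right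
    neighbourhoods, and there are only countably many values. *)
Definition grid (k : nat) (u : R) : R := (Num.truncn (u * k.+1%:R)).+1%:R / k.+1%:R.

Lemma grid_gt k u : u < grid k u.
Proof. by rewrite ltr_pdivlMr// truncnS_gt. Qed.

Lemma grid_le k u : 0 <= u -> grid k u <= u + k.+1%:R^-1.
Proof.
move=> u0; rewrite ler_pdivrMr// mulrDl mulVf// -natr1 lerD2r.
by rewrite truncn_le mulr_ge0.
Qed.

Lemma grid_value (f : R -> nat) u : exists m, `[< exists k, f (grid k u) = m >].
Proof. by exists (f (grid 0 u)); apply/asboolP; exists 0%N. Qed.

(* For a nondecreasing right-continuous path this is [f u]; unlike evaluation
   at a random time, it is measurable for arbitrary paths. *)
Definition rceval (f : R -> nat) (u : R) : nat := ex_minn (grid_value f u).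

Lemma rceval_leP f u m : (rceval f u <= m)%N <-> exists k, (f (grid k u) <= m)%N.
Proof.
rewrite /rceval; case: ex_minnP => n /asboolP[k fk] nmin; split.
  by move=> nm; exists k; rewrite fk.
by move=> [j]; apply: leq_trans; apply: nmin; apply/asboolP; exists j.
Qed.

Lemma rcevalE (f : R -> nat) u : 0 <= u ->
  (forall v, u <= v -> (f u <= f v)%N) ->
  (\forall v \near u^'+, f v = f u) -> rceval f u = f u.
Proof.
move=> u0 fmono [e /= e0 fe].
apply/eqP; rewrite eqn_leq; apply/andP; split.
  apply/rceval_leP; exists (Num.truncn e^-1).
  rewrite fe// ?grid_gt//=.
  rewrite ltr0_norm ?subr_lt0 ?grid_gt// opprB ltrBlDl.
  apply: (le_lt_trans (grid_le _ u0)); rewrite ltrD2l.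
  by rewrite invf_plt ?posrE// truncnS_gt.
have [k] : exists k, (f (grid k u) <= rceval f u)%N by apply/rceval_leP.
by apply: leq_trans; apply: fmono; rewrite ltW// grid_gt.
Qed.

Lemma measurable_natP d (W : measurableType d) (f : W -> nat) :
  (forall m, measurable [set w | (f w <= m)%N]) -> measurable_fun setT f.
Proof.
move=> mf _ B _; rewrite setTI.
have -> : f @^-1` B = \bigcup_(m in B) (f @^-1` [set m]).
  by apply/seteqP; split=> w /= => [fB|[m Bm ->//]]; exists (f w).
apply: bigcup_measurable => m _.
have -> : f @^-1` [set m] = [set w | (f w <= m)%N] `\` [set w | (f w < m)%N].
  apply/seteqP; split=> w /= => [->|[h /negP]]; first by rewrite leqnn ltnn.
  by rewrite -leqNgt => h'; apply/eqP; rewrite eqn_leq h.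
apply: measurableD => //; case: m => [|m]; last exact: mf.
by rewrite [X in measurable X](_ : _ = set0)//; apply/seteqP; split.
Qed.

(** The event that the value is at most m is a countable union over the mesh k and the cell j of the
    grid, so the path is only evaluated at fixed nonnegative times. *)
Lemma measurable_rceval d (W : measurableType d) (X : R -> W -> nat) (L : W -> R) :
  (forall u, 0 <= u -> measurable_fun setT (X u)) -> measurable_fun setT L ->
  measurable_fun setT (fun w => rceval (X ^~ w) (L w)).
Proof.
move=> mX mL; apply: measurable_natP => m.
have mtr k : measurable_fun setT (fun w => Num.truncn (L w * k.+1%:R)).
  apply: measurable_natP => n.
  have := measurable_funM mL (measurable_cst (k.+1%:R : R)).
  move=> /(_ measurableT `]-oo, n.+1%:R[%classic (measurable_itv _)).
  rewrite setTI; congr measurable; apply/seteqP; split=> w /=;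
    by rewrite in_itv/= truncn_le_nat.
have -> : [set w | (rceval (X ^~ w) (L w) <= m)%N] = \bigcup_k \bigcup_j
   ([set w | Num.truncn (L w * k.+1%:R) = j] `&` [set w | (X (j.+1%:R / k.+1%:R) w <= m)%N]).
  apply/seteqP; split=> w /=.
    by move=> /rceval_leP[k hk]; exists k => //; exists (Num.truncn (L w * k.+1%:R)).
  by move=> [k _ [j _ /= [<- h]]]; apply/rceval_leP; exists k.
apply: bigcupT_measurable => k; apply: bigcupT_measurable => j.
apply: measurableI.
  by have := mtr k measurableT [set j] I; rewrite setTI.
have : measurable_fun setT (X (j.+1%:R / k.+1%:R)) by apply: mX; rewrite divr_ge0.
by move=> /(_ measurableT [set n | (n <= m)%N] I); rewrite setTI.
Qed.

End RightContinuousEvaluation.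

(** * Mean and exponential moments of one Poisson coordinate *)

Section PoissonIntegrals.
Context {disp : measure_display} {T : measurableType disp} {R : realType}.
Variable P : probability T R.
Local Open Scope ereal_scope.

Lemma poisson_rceval rate (X : R -> T -> nat) w u : poisson_process P rate X ->
  (0 <= u)%R -> rceval (X ^~ w) u = X u w.
Proof.
move=> [_ _ Xm Xrc _ _] u0; apply: rcevalE => // [v uv|]; first exact: Xm.
exact: Xrc.
Qed.

Variable X : R -> T -> nat.
Hypothesis hX : poisson_process P 1%R X.

Lemma poisson_prob_eq u n : (0 <= u)%R ->
  P (X u @^-1` [set n]) = (u ^+ n / n`!%:R * expR (- u))%:E.
Proof.
move=> u0; have [_ X0 _ _ law _] := hX.
have := law 0%R u (lexx _) u0 [set n]; rewrite subr0 mul1r.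
have -> : (fun w => X u w - X 0%R w)%N = X u by apply/funext => w; rewrite X0 subn0.
(* At u = 0 the law is the Dirac mass at 0, which the formula reproduces because 0 ^+ 0 = 1. *)
move=> ->; rewrite /poisson_prob; case: ifPn => [ugt0|].
  by rewrite esum_set1 ?lee_fin ?poisson_pmf_ge0// /poisson_pmf ugt0.
rewrite -leNgt => ule0; have -> : u = 0%R by apply/eqP; rewrite eq_le ule0.
rewrite oppr0 expR0 mulr1 diracE; case: n => [|n]; first by rewrite mem_set// expr0 fact0 divr1.
by rewrite memNset//= expr0n mul0r.
Qed.

Lemma poisson_integral (g : nat -> R) u : (0 <= u)%R -> (forall n, 0 <= g n)%R ->
  \int[P]_w (g (X u w))%:E = \sum_(n <oo) (g n * (u ^+ n / n`!%:R * expR (- u)))%:E.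
Proof.
move=> u0 g0; have mX : measurable_fun setT (X u) by case: hX => mX *; exact: mX.
have mXn n : measurable (X u @^-1` [set n]).
  by have := mX measurableT [set n] I; rewrite setTI.
have UX : \bigcup_n (X u @^-1` [set n]) = setT.
  by rewrite -preimage_bigcup; apply/seteqP; split=> // w _; exists (X u w).
rewrite -[X in \int[_]_(_ in X) _]UX ge0_integral_bigcup//=.
- apply: eq_eseriesr => n _.
  rewrite (eq_integral (fun=> (g n)%:E)) => [|w /[!inE]/= ->//].
  by rewrite integral_cst// EFinM; congr (_ * _); exact: poisson_prob_eq.
- rewrite UX; apply/measurable_EFinP; exact: measurableT_comp mX.
- by move=> w _; rewrite lee_fin.
- by apply/trivIsetP => i j _ _ ij; apply/seteqP; split=> // w [/= -> /eqP]; rewrite (negbTE ij).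
Qed.

Lemma exp_series (x : R) : (0 <= x)%R ->
  \sum_(n <oo) (x ^+ n / n`!%:R)%:E = (expR x)%:E.
Proof.
move=> x0; rewrite expRE -EFin_lim; last first.
  rewrite /pseries/=; under eq_fun do rewrite mulrC.
  exact: is_cvg_series_exp_coeff.
apply/congr_lim/funext => n/=; rewrite /pseries/= /series/= -sumEFin//.
by under eq_bigr do rewrite mulrC.
Qed.

Lemma poisson_exp a u : (0 <= u)%R ->
  \int[P]_w (expR (a * (X u w)%:R))%:E = (expR (u * (expR a - 1)))%:E.
Proof.
move=> u0; rewrite (poisson_integral (g := fun n => expR (a * n%:R)))//.
transitivity (\sum_(n <oo) ((expR (- u))%:E * ((u * expR a) ^+ n / n`!%:R)%:E)).
  apply: eq_eseriesr => n _; rewrite -EFinM exprMn -expRM_natr; congr EFin; ring.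
rewrite nneseriesZl; last first.
  by move=> n _; rewrite lee_fin divr_ge0// exprn_ge0// mulr_ge0// expR_ge0.
rewrite exp_series ?mulr_ge0 ?expR_ge0// -EFinM -expRD; congr (expR _)%:E.
by rewrite mulrBr mulr1 addrC.
Qed.

Lemma poisson_mean u : (0 <= u)%R -> \int[P]_w ((X u w)%:R : R)%:E = u%:E.
Proof.
move=> u0; rewrite (poisson_integral (g := fun n => n%:R))//.
have t0 n : 0 <= (n%:R * (u ^+ n / n`!%:R * expR (- u)) : R)%:E.
  by rewrite lee_fin !mulr_ge0 ?expR_ge0 ?exprn_ge0 ?invr_ge0.
rewrite nneseries_recl// mul0r add0e -[X in X = _](nneseries_addn 1)//.
transitivity (\sum_(n <oo) ((u * expR (- u))%:E * (u ^+ n / n`!%:R)%:E)).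
  apply: eq_eseriesr => n _; rewrite -EFinM addn1 exprS factS natrM invfM; congr EFin.
  have n1 : (n.+1%:R : R) != 0%R by rewrite pnatr_eq0.
  have nf : (n`!%:R : R) != 0%R by rewrite pnatr_eq0 -lt0n fact_gt0.
  move: n1 nf; move: (n.+1%:R : R)%R (n`!%:R : R)%R => a b a0 b0.
  by field; rewrite a0 b0.
rewrite nneseriesZl; last by move=> n _; rewrite lee_fin divr_ge0// exprn_ge0.
by rewrite exp_series// -EFinM -mulrA -expRD addNr expR0 mulr1.
Qed.

End PoissonIntegrals.

Section PredictableIntensities.
Context {R : realType}.

(** Takes the place of the Poisson cumulant exp x - 1, which is the case p = 1. The factor p is the
    price of arbitrary dependence between p coordinates; the first-order behaviour at 0 is
    unchanged. *)
Definition psi (p : nat) (x : R) : R := (expR (p%:R * x) - 1) / p%:R.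

Lemma psi_le_linear p (e : R) : (0 < p)%N -> 0 < e ->
  exists2 s, 0 < s & forall x, 0 <= x -> x <= s -> psi p x <= (1 + e) * x.
Proof.
move=> p0 e0; have pr : 0 < p%:R :> R by rewrite ltr0n.
have e1 : 0 < 1 + e by lra.
(* With y = p x this says y <= e / (1 + e), that is 1 / (1 - y) <= 1 + e; then exp y <= 1 / (1 - y)
   gives exp y - 1 <= y / (1 - y) <= (1 + e) y. *)
exists (e / (1 + e) / p%:R) => [|x x0]; first by rewrite !divr_gt0.
rewrite ler_pdivlMr// ler_pdivlMr// => xs.
rewrite /psi ler_pdivrMr//; set y := p%:R * x.
have y0 : 0 <= y by rewrite mulr_ge0// ltW.
have ye : y * (1 + e) <= e by rewrite /y [p%:R * x]mulrC.
have y1 : y < 1 by rewrite -(ltr_pM2r e1); apply: (le_lt_trans ye); lra.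
have ex : expR y * (1 - y) <= 1.
  rewrite -[leRHS](expR0 R) -(subrr y) expRD ler_pM2l ?expR_gt0//.
  by have := expR_ge1Dx (- y).
have -> : (1 + e) * x * p%:R = (1 + e) * y by rewrite /y; ring.
rewrite -(ler_pM2r (_ : 0 < 1 - y)) ?subr_gt0//; nra.
Qed.

(** With y = p x: exp (- y) <= 1 / (1 + y) <= 1 - y + y^2. *)
Lemma psi_opp_le p (x : R) : (0 < p)%N -> 0 <= x -> psi p (- x) <= - x + p%:R * x ^+ 2.
Proof.
move=> p0 x0; have pr : 0 < p%:R :> R by rewrite ltr0n.
rewrite /psi ler_pdivrMr// mulrN expRN; set y := p%:R * x.
have y0 : 0 <= y by rewrite mulr_ge0// ltW.
have y1 : 0 < 1 + y by lra.
have -> : (- x + p%:R * x ^+ 2) * p%:R = - y + y ^+ 2 by rewrite /y; ring.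
rewrite lerBlDr; apply: (@le_trans _ _ (1 + y)^-1).
  by rewrite lef_pV2 ?posrE ?expR_gt0// expR_ge1Dx.
rewrite -[leLHS]mul1r ler_pdivrMr//; nra.
Qed.

(** Sum the tangent inequalities exp z_i >= exp m (1 + z_i - m) at the mean m; the linear terms
    cancel. *)
Lemma expR_mean_le (p : nat) (z : 'I_p -> R) : (0 < p)%N ->
  expR ((\sum_i z i) / p%:R) <= (\sum_i expR (z i)) / p%:R.
Proof.
move=> p0; have pr : 0 < p%:R :> R by rewrite ltr0n.
set m := _ / _; rewrite ler_pdivlMr//.
have -> : expR m * p%:R = \sum_i expR m * (1 + (z i - m)).
  rewrite -mulr_sumr big_split/= sumrB !sumr_const card_ord.
  rewrite -[in m *+ p]mulr_natr /m mulfVK ?gt_eqF// subrr addr0.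
  by [].
apply: ler_sum => i _; rewrite -[in leRHS](subrKC m (z i)) expRD.
by rewrite ler_pM2l ?expR_gt0// expR_ge1Dx.
Qed.

Context {disp : measure_display} {T : measurableType disp}.
Variable P : probability T R.
Local Open Scope ereal_scope.

(* The coordinates of X may depend on each other arbitrarily: Jensen's
   inequality, after centering each exponent, reduces to the marginals. *)
Lemma poisson_vector_exp_le (p : nat) (X : 'I_p -> R -> T -> nat)
    (u theta : 'I_p -> R) : (0 < p)%N ->
  (forall i, poisson_process P 1%R (X i)) -> (forall i, 0 <= u i)%R ->
  \int[P]_w (expR (\sum_i theta i * (X i (u i) w)%:R))%:E <=
  (expR (\sum_i u i * psi p (theta i)))%:E.
Proof.
move=> p0 hX u0; have pr : (0 < p%:R :> R)%R by rewrite ltr0n.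
have mX i : measurable_fun setT (X i (u i)) by case: (hX i) => mX *; exact: mX.
(* The log-moment of p theta_i X_i. After subtracting it every exponential has mean 1, and the bound
   is the exponential of the average of the c_i; without centering it would be the larger average of
   the exponentials. *)
pose c i : R := (u i * (expR (p%:R * theta i) - 1))%R.
pose K : R := (expR ((\sum_i c i) / p%:R) / p%:R)%R.
have K0 : (0 <= K)%R by rewrite divr_ge0// ?expR_ge0.
have KE : (expR (\sum_i u i * psi p (theta i)) = K * p%:R)%R.
  rewrite /K mulfVK ?gt_eqF// mulr_suml; congr expR.
  by apply: eq_bigr => i _; rewrite /c /psi mulrA.
have mexp i (a : R) : measurable_fun setT (fun w => expR (a * (X i (u i) w)%:R)).
  apply: measurableT_comp => //; apply: measurable_funM => //.
  exact: measurableT_comp (mX i).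
apply: (@le_trans _ _ (\int[P]_w (\sum_i
    (K * expR (- c i))%:E * (expR (p%:R * theta i * (X i (u i) w)%:R))%:E))).
  apply: ge0_le_integral => //=.
  - apply/measurable_EFinP; apply: measurableT_comp => //.
    apply: measurable_sum => i; apply: measurable_funM => //.
    exact: measurableT_comp (mX i).
  - apply: emeasurable_sum => i; apply/measurable_EFinP.
    exact: measurable_funM.
  - move=> w _; rewrite sumEFin lee_fin.
    have -> : (\sum_i theta i * (X i (u i) w)%:R =
      (\sum_i c i) / p%:R + (\sum_i (p%:R * theta i * (X i (u i) w)%:R - c i)) / p%:R)%R.
      rewrite -mulrDl -big_split/= mulr_suml; apply: eq_bigr => i _.
      by rewrite subrKC -[(p%:R * _ * _)%R]mulrA [(p%:R * _)%R]mulrC mulfK// gt_eqF.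
    rewrite expRD; apply: (@le_trans _ _ (expR ((\sum_i c i) / p%:R) *
       ((\sum_i expR (p%:R * theta i * (X i (u i) w)%:R - c i)) / p%:R))%R).
      by rewrite ler_pM2l ?expR_gt0// expR_mean_le.
    rewrite mulrA mulrAC mulr_sumr ler_sum// => i _.
    by rewrite /K expRD [leRHS]mulrAC mulrA.
rewrite ge0_integral_sum//; last 2 first.
- by move=> i; apply/measurable_EFinP; exact: measurable_funM.
- by move=> i w _; rewrite -EFinM lee_fin mulr_ge0// ?mulr_ge0// ?expR_ge0.
rewrite (eq_bigr (fun=> K%:E)).
  by rewrite sumEFin sumr_const card_ord KE mulr_natr.
move=> i _; rewrite ge0_integralZl//; last 2 first.
- exact/measurable_EFinP.
- by rewrite lee_fin mulr_ge0// expR_ge0.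
rewrite (poisson_exp (hX i))// -EFinM -mulrA -/(c i) -expRD addNr expR0 mulr1.
by [].
Qed.

End PredictableIntensities.

Section Predictable.
Context {disp : measure_display} {T : measurableType disp} {R : realType}.
Variable P : probability T R.
Context {p : nat}.
Variable N : int -> 'I_p -> R -> T -> nat.
Hypothesis hN : iid_poisson P N.
Local Open Scope ereal_scope.

Definition past_measurable d (S : measurableType d) t (f : T -> S) :=
  measurable_fun setT (f : g_sigma_algebraType (past_gen N t) -> S).

Lemma iid_poissonE t i u w : (0 <= u)%R -> rceval (N t i ^~ w) u = N t i u w.
Proof. by move=> u0; case: hN => hP _ _; apply: (poisson_rceval _ (hP t i)). Qed.

(** The intensity reads the first copy of the sample space and the path the second, so the past can
    be frozen while the present is integrated. *)
Lemma measurable_future_rceval t i (L : T -> R) : past_measurable (t - 1) L ->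
  measurable_fun setT (fun x : g_sigma_algebraType (past_gen N (t - 1)) *
     g_sigma_algebraType (present_gen N t) => rceval (N t i ^~ x.2) (L x.1)).
Proof.
move=> mL.
apply: (measurable_rceval (X := fun u (x : g_sigma_algebraType (past_gen N (t - 1)) *
     g_sigma_algebraType (present_gen N t)) => N t i u x.2) (L := L \o fst)).
- move=> u u0; apply: (measurableT_comp (f := N t i u : g_sigma_algebraType (present_gen N t) -> nat)) => //.
  by move=> _ B mB; apply: sub_sigma_algebra; exists (i, u) => //; exists B.
- exact: measurableT_comp mL _.
Qed.

Lemma past_present_independent t (C E : set T) :
  @measurable _ (g_sigma_algebraType (past_gen N (t - 1))) C ->
  @measurable _ (g_sigma_algebraType (present_gen N t)) E ->
  P (id @^-1` C `&` id @^-1` E) = (P (id @^-1` C) * P (id @^-1` E))%E.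
Proof. by move=> mC mE; exact: (past_independent hN mC mE). Qed.

Lemma predictable_measurable t i (L : T -> R) : past_measurable (t - 1) L ->
  (forall w, 0 <= L w)%R -> measurable_fun setT (fun w => N t i (L w) w).
Proof.
move=> mL L0; have mL' : measurable_fun setT L.
  have mX := measurable_id_sub (@past_gen_measurable _ _ _ _ _ _ hN (t - 1)).
  exact: (measurableT_comp mL mX).
have -> : (fun w => N t i (L w) w) = (fun w => rceval (N t i ^~ w) (L w)).
  by apply/funext => w; rewrite iid_poissonE.
by apply: measurable_rceval => // u; exact: iid_measurable hN _ _ _.
Qed.

Lemma predictable_mean t i (L : T -> R) : past_measurable (t - 1) L ->
  (forall w, 0 <= L w)%R ->
  \int[P]_w ((N t i (L w) w)%:R : R)%:E = \int[P]_w (L w)%:E.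
Proof.
move=> mL L0.
have mX1 := measurable_id_sub (@past_gen_measurable _ _ _ _ _ _ hN (t - 1)).
have mX2 := measurable_id_sub (@present_gen_measurable _ _ _ _ _ _ hN t).
pose f (x : g_sigma_algebraType (past_gen N (t - 1)) *
     g_sigma_algebraType (present_gen N t)) := ((rceval (N t i ^~ x.2) (L x.1))%:R : R)%:E.
transitivity (\int[P]_w \int[P]_w' f (w, w')).
  rewrite -(fubini_independent mX1 mX2 (@past_present_independent t) (f := f)).
  - by apply: eq_integral => w _; rewrite /f /= iid_poissonE.
  - apply/measurable_EFinP.
    exact: measurableT_comp (measurable_future_rceval _ mL).
  - by move=> x; rewrite lee_fin.
apply: eq_integral => w _; rewrite /f; under eq_integral do rewrite /= iid_poissonE//.
by case: hN => hP _ _; exact: poisson_mean.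
Qed.

(** Once the past is frozen, [Z] is a constant and the intensities are numbers, so the bound at
    deterministic times applies before the past is integrated. *)
Lemma predictable_exp_le t (Z : T -> R) (L : 'I_p -> T -> R) (theta : 'I_p -> R) :
  (0 < p)%N -> past_measurable (t - 1) Z -> (forall w, 0 <= Z w)%R ->
  (forall i, past_measurable (t - 1) (L i)) -> (forall i w, 0 <= L i w)%R ->
  \int[P]_w (Z w * expR (\sum_i theta i * (N t i (L i w) w)%:R))%:E <=
  \int[P]_w (Z w * expR (\sum_i L i w * psi p (theta i)))%:E.
Proof.
move=> p0 mZ Z0 mL L0.
have mX1 := measurable_id_sub (@past_gen_measurable _ _ _ _ _ _ hN (t - 1)).
have mX2 := measurable_id_sub (@present_gen_measurable _ _ _ _ _ _ hN t).
pose f (x : g_sigma_algebraType (past_gen N (t - 1)) *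
     g_sigma_algebraType (present_gen N t)) :=
  (Z x.1 * expR (\sum_i theta i * (rceval (N t i ^~ x.2) (L i x.1))%:R))%:E.
have -> : \int[P]_w (Z w * expR (\sum_i theta i * (N t i (L i w) w)%:R))%:E =
    \int[P]_w f (w, w).
  apply: eq_integral => w _; rewrite /f/=.
  by under [in RHS]eq_bigr do rewrite iid_poissonE//.
apply: (fubini_independent_le mX1 mX2 (@past_present_independent t) (f := f)
  (g := fun w => (Z w * expR (\sum_i L i w * psi p (theta i)))%:E)).
- apply/measurable_EFinP; apply: measurable_funM; first exact: measurableT_comp mZ _.
  apply: measurableT_comp => //; apply: measurable_sum => i.
  apply: measurable_funM => //.
  exact: measurableT_comp (measurable_future_rceval _ (mL i)).
- by move=> x; rewrite lee_fin mulr_ge0// expR_ge0.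
- apply/measurable_EFinP; apply: measurable_funM => //.
  apply: measurableT_comp => //; apply: measurable_sum => i.
  by apply: measurable_funM; [exact: mL|exact: measurable_cst].
move=> w; rewrite /f; under eq_integral => w' _.
  rewrite EFinM; under eq_bigr do rewrite iid_poissonE//=; over.
rewrite /= ge0_integralZl//.
- rewrite EFinM; apply: lee_wpmul2l; first by rewrite lee_fin.
  apply: poisson_vector_exp_le => // i; by case: hN.
- apply/measurable_EFinP; apply: measurableT_comp => //; apply: measurable_sum => i.
  apply: measurable_funM => //.
  by apply: measurableT_comp => //; exact: iid_measurable hN _ _ _ _.
- by rewrite lee_fin.
Qed.

End Predictable.

(** * The recursion started from zero *)

Section Histories.
Context {R : realType} {p q : nat}.
Variables (A B : 'I_q -> 'M[R]_p) (d : 'cV[R]_p).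

Definition state : Type := ('cV[nat]_p * 'cV[R]_p)%type.
Definition noise : Type := int * ('I_p * R) -> nat.

(* [h j] is the state at lag [j]. *)
Definition intensity (h : nat -> state) : 'cV[R]_p :=
  d + \sum_(i < q) A i *m (h i).2 + \sum_(i < q) B i *m natcol (h i).1.

Definition hstep (f : 'I_p -> R -> nat) (h : nat -> state) (j : nat) : state :=
  if j is j'.+1 then h j'
  else (\col_i rceval (f i) (intensity h i 0), intensity h).

(* The states at times t, t - 1, ... of the recursion started from zero at
   time t - n. *)
Fixpoint history (f : noise) (n : nat) (t : int) : nat -> state :=
  if n is n'.+1 then hstep (fun i u => f (t, (i, u))) (history f n' (t - 1))
  else fun=> (const_mx 0%N, 0).

Definition state_le (s s' : state) : Prop :=
  (forall i, (s.1 i 0%R <= s'.1 i 0%R)%N) /\ mxle s.2 s'.2.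

Lemma natcol_le (y y' : 'cV[nat]_p) :
  (forall i, (y i 0%R <= y' i 0%R)%N) -> mxle (natcol y : 'cV[R]_p) (natcol y').
Proof. by move=> h i j; rewrite (ord1 j) !mxE ler_nat. Qed.

Lemma natcol_ge0 (y : 'cV[nat]_p) : mxle 0 (natcol y : 'cV[R]_p).
Proof. by move=> i j; rewrite !mxE. Qed.

Lemma state_leS s : state_le s s.
Proof. by split. Qed.

(** For j > n the subtraction truncates to 0 and both sides are the zero initial state. *)
Lemma history_lag f n t j : history f n t j = history f (n - j) (t - j%:Z) 0.
Proof.
elim: j n t => [|j IH] n t; first by rewrite subn0 subr0.
case: n => [|n] /=; first by [].
by rewrite IH subSS -addrA -opprD intS.
Qed.

Lemma history_shift f n t (h : int) :
  history (fun k => f (k.1 + h, k.2)) n t = history f n (t + h).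
Proof.
elim: n t => [//|n IH] t /=; rewrite IH.
by rewrite addrAC.
Qed.

Hypotheses (A0 : forall i, mxle 0 (A i)) (B0 : forall i, mxle 0 (B i)).
Hypothesis d0 : mxle 0 d.

Lemma intensity_ge h : (forall j, mxle 0 (h j).2) -> mxle d (intensity h).
Proof.
move=> h0.
have hA : mxle 0 (\sum_(i < q) A i *m (h i).2).
  by apply: mxge0_sum => i; exact: mxge0_mul.
have hB : mxle 0 (\sum_(i < q) B i *m (natcol (h i).1 : 'cV[R]_p)).
  by apply: mxge0_sum => i; apply: mxge0_mul => //; exact: natcol_ge0.
by have := mxle_add (mxle_add (mxle_refl d) hA) hB; rewrite !addr0.
Qed.

Lemma intensity_le h h' : (forall j, state_le (h j) (h' j)) ->
  mxle (intensity h) (intensity h').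
Proof.
move=> hh; rewrite /intensity; apply: mxle_add.
  by apply: mxle_add => //; apply: mxle_sum => i; apply: mxle_mulr => //; case: (hh i).
apply: mxle_sum => i; apply: mxle_mulr => //; apply: natcol_le.
by case: (hh i).
Qed.

Lemma history_ge0 f n t j : mxle 0 (history f n t j).2.
Proof.
elim: n t j => [|n IH] t j /=; first exact: mxle_refl.
case: j => [|j] /=; last exact: IH.
apply: mxle_trans d0 _; apply: intensity_ge => j; exact: IH.
Qed.

Section MonotonePath.
Variable f : noise.
Hypothesis fmono : forall t i u v, 0 <= u -> u <= v ->
  (rceval (fun u => f (t, (i, u))) u <= rceval (fun u => f (t, (i, u))) v)%N.

(** Nonnegative coefficients and nondecreasing paths make a step order-preserving. Nonnegativity of
    [h] keeps the evaluation times in the range where paths are monotone. *)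
Lemma hstep_le t h h' : (forall j, mxle 0 (h j).2) ->
  (forall j, state_le (h j) (h' j)) ->
  forall j, state_le (hstep (fun i u => f (t, (i, u))) h j)
                     (hstep (fun i u => f (t, (i, u))) h' j).
Proof.
move=> h0 hh [|j] /=; last exact: hh.
have le := intensity_le hh; split=> //= i; rewrite [X in (X <= _)%N]mxE [X in (_ <= X)%N]mxE.
apply: fmono; last exact: le.
exact/mxge0E/(mxle_trans d0)/intensity_ge.
Qed.

Lemma history_le n t j : state_le (history f n t j) (history f n.+1 t j).
Proof.
elim: n t j => [|n IH] t j.
  split=> [i|]; first by rewrite /= mxE.
  exact: (@history_ge0 f 1).
apply: hstep_le => j'; [exact: history_ge0|exact: IH].
Qed.

Lemma history_le_solution (X : int -> state) :
  (forall t, mxle 0 (X t).2) ->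
  (forall t i, (X t).1 i 0 = rceval (fun u => f (t, (i, u))) ((X t).2 i 0)) ->
  (forall t, (X t).2 = intensity (fun j => X (t - j.+1%:Z))) ->
  forall n t j, state_le (history f n t j) (X (t - j%:Z)).
Proof.
move=> X0 XY Xl; elim=> [|n IH] t j; first by split=> [i|]; [rewrite mxE|exact: X0].
case: j => [|j] /=; last first.
  by have := IH (t - 1) j; rewrite -addrA -opprD intS.
have le : mxle (intensity (history f n (t - 1))) (X t).2.
  rewrite Xl; apply: intensity_le => j; have := IH (t - 1) j.
  by rewrite -addrA -opprD intS.
rewrite subr0; split=> //= i; rewrite mxE XY; apply: fmono; last exact: le.
by apply/mxge0E/(mxle_trans d0)/intensity_ge => j; exact: history_ge0.
Qed.

End MonotonePath.

Lemma intensity_entry h i : intensity h i 0 = d i 0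
    + \sum_(k < q) \sum_j A k i j * (h k).2 j 0
    + \sum_(k < q) \sum_j B k i j * ((h k).1 j 0)%:R.
Proof.
rewrite /intensity !mxE !summxE; congr (_ + _ + _).
  by apply: eq_bigr => k _; rewrite mxE.
by apply: eq_bigr => k _; rewrite mxE; apply: eq_bigr => j _; rewrite mxE.
Qed.

Lemma measurable_intensity dW (W : measurableType dW) (h : W -> nat -> state) :
  (forall j i, measurable_fun setT (fun w => (h w j).1 i 0)) ->
  (forall j i, measurable_fun setT (fun w => (h w j).2 i 0)) ->
  forall i, measurable_fun setT (fun w => intensity (h w) i 0).
Proof.
move=> h1 h2 i.
under eq_fun do rewrite intensity_entry.
apply: measurable_funD; first apply: measurable_funD => //.
  apply: measurable_sum => k; apply: measurable_sum => j.
  by apply: measurable_funM => //; exact: h2.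
apply: measurable_sum => k; apply: measurable_sum => j.
apply: measurable_funM => //.
exact: measurableT_comp (h1 _ _).
Qed.

(** [W] is arbitrary because two cases are needed: the sample space with the sigma-algebra of the
    past, for non-anticipation, and the space of noise paths, for stationarity. *)
Lemma measurable_history dW (W : measurableType dW) (f : W -> noise) n t :
  (forall s i u, s <= t -> 0 <= u -> measurable_fun setT (fun w => f w (s, (i, u)))) ->
  forall j i, measurable_fun setT (fun w => (history (f w) n t j).1 i 0) /\
              measurable_fun setT (fun w => (history (f w) n t j).2 i 0).
Proof.
elim: n t => [|n IH] t mf j i /=; first by split; exact: measurable_cst.
have mf' s i' u : s <= t - 1 -> 0 <= u -> measurable_fun setT (fun w => f w (s, (i', u))).
  by move=> st u0; apply: mf => //; apply: le_trans st _; rewrite gerDl.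
case: j => [|j] /=; last by have [] := IH (t - 1) mf' j i.
have mI k := measurable_intensity (fun j i => proj1 (IH (t - 1) mf' j i))
  (fun j i => proj2 (IH (t - 1) mf' j i)) k.
split; last exact: mI.
rewrite (_ : (fun w => _) = (fun w => rceval ((fun u w => f w (t, (i, u))) ^~ w)
   (intensity (history (f w) n (t - 1)) i 0))).
  by apply: measurable_rceval => // u u0; exact: mf.
by apply/funext => w; rewrite mxE.
Qed.

End Histories.

(** * Lyapunov functions *)

Section RowTimesColumn.
Context {R : realType} {p : nat}.
Implicit Types (u : 'rV[R]_p) (x y : 'cV[R]_p).

Lemma row_mul_col u x : (u *m x) 0 0 = \sum_k u 0 k * x k 0.
Proof. by rewrite mxE. Qed.

Lemma row_mul_colB u x y : (u *m (x - y)) 0 0 = (u *m x) 0 0 - (u *m y) 0 0.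
Proof. by rewrite mulmxBr mxE [X in _ + X]mxE. Qed.

End RowTimesColumn.

Section Lyapunov.
Context {R : realType} {p q : nat}.
Variables (A B : 'I_q -> 'M[R]_p) (d : 'cV[R]_p) (v : 'rV[R]_p).

Definition contribution (i : 'I_q) (s : state) : R :=
  (v *m A i *m s.2) 0 0 + (v *m B i *m natcol s.1) 0 0.

(** The pending influence of the states: the one at lag j enters an intensity through [A i] and
    [B i] in i - j + 1 steps. The weight loses a factor g at each step and is 1 just before
    release. *)
Definition lyapunov (g : R) (h : nat -> state) : R :=
  \sum_(i < q) \sum_(j < i.+1) g ^+ (i - j) * contribution i (h j).

Definition lyap_alpha (g : R) : 'rV[R]_p := \sum_(i < q) g ^+ i.+1 *: (v *m A i).
Definition lyap_beta (g : R) : 'rV[R]_p := \sum_(i < q) g ^+ i.+1 *: (v *m B i).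

Lemma contribution_sum (h : nat -> state) :
  \sum_(i < q) contribution i (h i) = (v *m (intensity A B d h - d)) 0 0.
Proof.
have -> : intensity A B d h - d =
    \sum_(i < q) A i *m (h i).2 + \sum_(i < q) B i *m natcol (h i).1.
  by rewrite /intensity addrC !addrA addNr add0r.
rewrite mulmxDr !mulmx_sumr mxE !summxE -big_split/=.
by apply: eq_bigr => i _; rewrite /contribution !mulmxA.
Qed.

(** Telescoping: the terms j = i, which sum to v (lambda - d), are released, the others move one lag
    further, and the new state enters at lag 0 with weights [lyap_alpha] and [lyap_beta]. *)
Lemma lyapunov_hstep g f (h : nat -> state) :
  g * lyapunov g (hstep A B d f h) =
  lyapunov g h - (v *m (intensity A B d h - d)) 0 0 +
  ((lyap_alpha g *m intensity A B d h) 0 0 +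
   \sum_k lyap_beta g 0 k * (rceval (f k) (intensity A B d h k 0))%:R).
Proof.
rewrite -contribution_sum /lyapunov -sumrB.
have -> : (lyap_alpha g *m intensity A B d h) 0 0 +
    \sum_k lyap_beta g 0 k * (rceval (f k) (intensity A B d h k 0))%:R =
    \sum_(i < q) g ^+ i.+1 * contribution i (hstep A B d f h 0).
  have -> : \sum_k lyap_beta g 0 k * (rceval (f k) (intensity A B d h k 0))%:R =
      (lyap_beta g *m natcol (hstep A B d f h 0).1) 0 0.
    by rewrite [RHS]mxE; apply: eq_bigr => k _; rewrite /= !mxE.
  rewrite /lyap_alpha /lyap_beta !mulmx_suml !summxE -big_split/=.
  by apply: eq_bigr => i _; rewrite -!scalemxAl mxE [X in _ + X]mxE mulrDr.
rewrite mulr_sumr -big_split/=; apply: eq_bigr => i _.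
rewrite big_ord_recl/= subn0 mulrDr mulrA -exprS addrC; congr (_ + _).
rewrite big_ord_recr/= subnn expr0 mul1r addrK mulr_sumr.
apply: eq_bigr => j _; rewrite /bump/= add1n mulrA -exprS.
by rewrite -subSn ?subSS// ltn_ord.
Qed.

(** Isolates the new counts in the last sum; the rest depends on the past only, the form that
    [predictable_exp_le] expects. *)
Lemma lyapunov_scaled g s f (h : nat -> state) : g != 0 ->
  s * lyapunov g (hstep A B d f h) =
  (s / g) * (lyapunov g h + (v *m d) 0 0) +
  \sum_k (s / g) * (lyap_alpha g 0 k - v 0 k) * intensity A B d h k 0 +
  \sum_k (s / g) * lyap_beta g 0 k * (rceval (f k) (intensity A B d h k 0))%:R.
Proof.
move=> g0; have -> : s * lyapunov g (hstep A B d f h) =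
    (s / g) * (g * lyapunov g (hstep A B d f h)) by rewrite mulrA mulfVK.
rewrite lyapunov_hstep.
rewrite row_mul_colB opprB.
have -> : \sum_k (s / g) * (lyap_alpha g 0 k - v 0 k) * intensity A B d h k 0 =
    (s / g) * ((lyap_alpha g *m intensity A B d h) 0 0 - (v *m intensity A B d h) 0 0).
  rewrite !row_mul_col -sumrB mulr_sumr.
  by apply: eq_bigr => k _; rewrite -mulrBl mulrA.
have -> : \sum_k (s / g) * lyap_beta g 0 k * (rceval (f k) (intensity A B d h k 0))%:R =
    (s / g) * \sum_k lyap_beta g 0 k * (rceval (f k) (intensity A B d h k 0))%:R.
  by rewrite mulr_sumr; apply: eq_bigr => k _; rewrite mulrA.
ring.
Qed.

Lemma measurable_mulmx_entry dW (W : measurableType dW) (u : 'rV[R]_p)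
    (x : W -> 'cV[R]_p) : (forall i, measurable_fun setT (fun w => x w i 0)) ->
  measurable_fun setT (fun w => (u *m x w) 0 0).
Proof.
move=> mx; under eq_fun do rewrite mxE.
by apply: measurable_sum => i; exact: measurable_funM.
Qed.

Lemma measurable_lyapunov dW (W : measurableType dW) g (h : W -> nat -> state) :
  (forall j i, measurable_fun setT (fun w => (h w j).1 i 0)) ->
  (forall j i, measurable_fun setT (fun w => (h w j).2 i 0)) ->
  measurable_fun setT (fun w => lyapunov g (h w)).
Proof.
move=> h1 h2; apply: measurable_sum => i; apply: measurable_sum => j.
apply: measurable_funM => //; apply: measurable_funD; apply: measurable_mulmx_entry => k.
  exact: h2.
under eq_fun do rewrite mxE; exact: measurableT_comp (h1 _ _).
Qed.

Hypotheses (A0 : forall i, mxle 0 (A i)) (B0 : forall i, mxle 0 (B i)).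
Hypothesis d0 : mxle 0 d.
Hypothesis v0 : mxle 0 v.

Lemma contribution_ge0 i s : mxle 0 s.2 -> 0 <= contribution i s.
Proof.
move=> s0; apply: addr_ge0; apply/mxge0E/mxge0_mul => //.
- exact: mxge0_mul.
- exact: mxge0_mul.
- exact: natcol_ge0.
Qed.

Lemma contribution_le i s s' : state_le s s' -> contribution i s <= contribution i s'.
Proof.
move=> [s1 s2]; apply: lerD.
  by apply: mxle_mulr => //; exact: mxge0_mul.
by apply: mxle_mulr; [exact: mxge0_mul|exact: natcol_le].
Qed.

Lemma lyapunov_le g h h' : 0 <= g -> (forall j, state_le (h j) (h' j)) ->
  lyapunov g h <= lyapunov g h'.
Proof.
move=> g0 hh; apply: ler_sum => i _; apply: ler_sum => j _.
by rewrite ler_wpM2l ?exprn_ge0// contribution_le.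
Qed.

(** Keeps only the terms j = i, those released at the next step. *)
Lemma intensity_le_lyapunov g h : 0 <= g -> (forall j, mxle 0 (h j).2) ->
  (v *m intensity A B d h) 0 0 <= lyapunov g h + (v *m d) 0 0.
Proof.
move=> g0 h0; rewrite -lerBlDr.
rewrite -row_mul_colB -contribution_sum; apply: ler_sum => i _.
rewrite big_ord_recr/= subnn expr0 mul1r lerDr.
by apply: sumr_ge0 => j _; rewrite mulr_ge0 ?exprn_ge0// contribution_ge0.
Qed.

End Lyapunov.

Section LyapunovExpectation.
Context {disp : measure_display} {T : measurableType disp} {R : realType}.
Variable P : probability T R.
Context {p q : nat}.
Variable N : int -> 'I_p -> R -> T -> nat.
Hypothesis hN : iid_poisson P N.
Variables (A B : 'I_q -> 'M[R]_p) (d : 'cV[R]_p).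
Hypotheses (p0 : (0 < p)%N).
Hypotheses (A0 : forall i, mxle 0 (A i)) (B0 : forall i, mxle 0 (B i)).
Hypothesis d0 : mxle 0 d.

Definition noise_of (w : T) : noise := fun k => N k.1 k.2.1 k.2.2 w.

Lemma past_measurable_noise t s i u : s <= t -> 0 <= u ->
  past_measurable N t (fun w => noise_of w (s, (i, u))).
Proof.
by move=> st u0 _ C mC; apply: sub_sigma_algebra; exists (s, (i, u)) => //; exists C.
Qed.

Lemma past_measurable_history n t j i :
  past_measurable N t (fun w => (history A B d (noise_of w) n t j).1 i 0) /\
  past_measurable N t (fun w => (history A B d (noise_of w) n t j).2 i 0).
Proof.
apply: (@measurable_history R p q A B d _ (g_sigma_algebraType (past_gen N t))
  noise_of n t) => s k u; exact: past_measurable_noise.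
Qed.

Lemma past_measurable_intensity n t i : past_measurable N t
  (fun w => intensity A B d (history A B d (noise_of w) n t) i 0).
Proof.
apply: (@measurable_intensity _ _ _ A B d _ (g_sigma_algebraType (past_gen N t))).
- by move=> j k; have [] := past_measurable_history n t j k.
- by move=> j k; have [] := past_measurable_history n t j k.
Qed.

Lemma past_measurable_lyapunov v g n t : past_measurable N t
  (fun w => lyapunov A B v g (history A B d (noise_of w) n t)).
Proof.
apply: (@measurable_lyapunov _ _ _ A B v _ (g_sigma_algebraType (past_gen N t))).
- by move=> j k; have [] := past_measurable_history n t j k.
- by move=> j k; have [] := past_measurable_history n t j k.
Qed.

Lemma past_measurable_measurable d' (S : measurableType d') t (f : T -> S) :
  past_measurable N t f -> measurable_fun setT f.
Proof.
move=> mf.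
exact: (measurableT_comp mf (measurable_id_sub (@past_gen_measurable _ _ _ _ _ _ hN t))).
Qed.

Local Open Scope ereal_scope.

(** Integrating the present replaces each new count by its intensity times [psi]. The sign of s is
    left free, so that both regimes start from here. *)
Lemma lyapunov_exp_step (v : 'rV[R]_p) (g s : R) n t : (g != 0)%R ->
  \int[P]_w (expR (s * lyapunov A B v g (history A B d (noise_of w) n.+1 t)))%:E <=
  \int[P]_w (let h := history A B d (noise_of w) n (t - 1) in
     expR ((s / g) * (lyapunov A B v g h + (v *m d) 0 0) +
       \sum_k ((s / g) * (lyap_alpha A v g 0 k - v 0 k)
               + psi p ((s / g) * lyap_beta B v g 0 k)) * intensity A B d h k 0))%:E.
Proof.
move=> g0; set hh := fun w => history A B d (noise_of w) n (t - 1).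
pose Z w := expR ((s / g) * (lyapunov A B v g (hh w) + (v *m d) 0 0) +
  \sum_k (s / g) * (lyap_alpha A v g 0 k - v 0 k) * intensity A B d (hh w) k 0)%R.
pose L k w := intensity A B d (hh w) k 0%R.
have L0 k w : (0 <= L k w)%R.
  by apply/mxge0E/(mxle_trans d0)/intensity_ge => // j; exact: history_ge0.
have := @predictable_exp_le _ _ _ P _ N hN t Z L (fun k => (s / g) * lyap_beta B v g 0 k)%R p0.
have mL k : past_measurable N (t - 1) (L k) by exact: past_measurable_intensity.
have mZ : past_measurable N (t - 1) Z.
  apply: measurableT_comp => //; apply: measurable_funD.
    apply: measurable_funM; first exact: measurable_cst.
    by apply: measurable_funD; [exact: past_measurable_lyapunov|exact: measurable_cst].
  apply: measurable_sum => k.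
  by apply: measurable_funM; [exact: measurable_cst|exact: mL].
move=> /(_ mZ (fun w => expR_ge0 _) mL L0).
have -> : \int[P]_w (Z w * expR (\sum_i s / g * lyap_beta B v g 0 i * (N t i (L i w) w)%:R)%R)%:E
  = \int[P]_w (expR (s * lyapunov A B v g (history A B d (noise_of w) n.+1 t)))%:E.
  apply: eq_integral => w _; rewrite /Z -expRD /= lyapunov_scaled//.
  congr (expR (_ + _))%:E; apply: eq_bigr => k _.
  congr (_ * _%:R)%R; exact/esym/(iid_poissonE hN)/L0.
have -> : \int[P]_w (Z w * expR (\sum_i L i w * psi p (s / g * lyap_beta B v g 0 i)))%:E =
  \int[P]_w (expR ((s / g) * (lyapunov A B v g (hh w) + (v *m d) 0 0) +
       \sum_k ((s / g) * (lyap_alpha A v g 0 k - v 0 k)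
       + psi p ((s / g) * lyap_beta B v g 0 k)) * intensity A B d (hh w) k 0))%:E.
  apply: eq_integral => w _; rewrite /Z -expRD -addrA; congr (expR (_ + _))%:E.
  by rewrite -big_split/=; apply: eq_bigr => k _; rewrite mulrDl [(L k w * _)%R]mulrC.
by [].
Qed.

End LyapunovExpectation.

(** * Geometric and harmonic rates *)

Section GrowthRates.
Context {R : realType}.

Lemma bernoulli (x : R) n : 0 <= x <= 1 -> 1 - n%:R * x <= (1 - x) ^+ n.
Proof.
move=> /andP[x0 x1]; elim: n => [|n IH]; first by rewrite expr0 mul0r subr0.
have n0 : 0 <= n%:R :> R by [].
have x10 : 0 <= 1 - x by rewrite subr_ge0.
rewrite exprS; apply: le_trans (ler_wpM2l x10 IH).
by rewrite -natr1; have := mulr_ge0 n0 (sqr_ge0 x); rewrite expr2; nra.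
Qed.

(** The power q + 1 pays for the weights, at most g^q, and for one more factor 1 + e = g conceded to
    [psi]. By Bernoulli, x = (1 - kappa) / (q + 1) gives (1 - x)^(q+1) >= kappa, hence g = 1 / (1 -
    x). *)
Lemma expansion_rate (kappa : R) q : 0 < kappa -> kappa < 1 ->
  exists2 g, 1 < g & g ^+ q.+1 * kappa <= 1.
Proof.
move=> k0 k1; pose x := (1 - kappa) / q.+1%:R.
have q0 : 0 < q.+1%:R :> R by [].
have x0 : 0 < x by rewrite divr_gt0// subr_gt0.
have x1 : x < 1.
  by rewrite ltr_pdivrMr// mul1r; apply: (@lt_le_trans _ _ 1); [lra|rewrite ler1n].
have hb : kappa <= (1 - x) ^+ q.+1.
  have := @bernoulli x q.+1; rewrite (ltW x0) (ltW x1) => /(_ isT).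
  by rewrite /x mulrC mulfVK ?gt_eqF//; lra.
have x10 : 0 < 1 - x by rewrite subr_gt0.
exists (1 - x)^-1; first by rewrite invf_gt1//; lra.
by rewrite exprVn mulrC ler_pdivrMr ?exprn_gt0// mul1r.
Qed.

(** Divided by c, the sum of the exponents 1 / (c (m + 2)), 1 / (c (m + 4)), ... with which v d is
    collected over n steps. *)
Definition harm2 (m : R) n : R := \sum_(k < n) (m + 2 * k.+1%:R)^-1.

Lemma harm2S m n : harm2 m n.+1 = (m + 2)^-1 + harm2 (m + 2) n.
Proof.
rewrite /harm2 big_ord_recl/= mulr1; congr (_ + _).
apply: eq_bigr => k _; rewrite /bump/= add1n -[k.+2%:R]natr1; congr (_^-1); ring.
Qed.

(** Twice [harm2 2 n] is a partial sum of the harmonic series without its first term. *)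
Lemma harm2_unbounded (C : R) : exists n, C < harm2 2 n.
Proof.
apply: contrapT => h.
have hC n : harm2 2 n <= C by rewrite leNgt; apply/negP => ?; apply: h; exists n.
apply: (@dvg_harmonic R); apply: nondecreasing_is_cvgn.
  by apply: nondecreasing_series => n _ _; rewrite /harmonic/= invr_ge0.
exists (1 + 2 * C) => _ [n _ <-].
apply: (@le_trans _ _ (series harmonic n.+1)).
  by rewrite /series/= big_nat_recr//= lerDl invr_ge0.
rewrite /series/= big_nat_recl//= invr1 lerD2l big_mkord.
apply: le_trans (_ : 2 * harm2 2 n <= _); last by rewrite ler_pM2l.
rewrite /harm2 mulr_sumr; apply: ler_sum => k _; rewrite /harmonic/=.
rewrite (_ : 2 + 2 * k.+1%:R = 2 * k.+2%:R :> R); last by rewrite -[k.+2%:R]natr1; ring.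
by rewrite invfM mulrA mulfV ?mul1r// pnatr_eq0.
Qed.

End GrowthRates.

Section ExponentialEstimates.
Context {disp : measure_display} {T : measurableType disp} {R : realType}.
Variable P : probability T R.
Context {p q : nat}.
Variable N : int -> 'I_p -> R -> T -> nat.
Hypothesis hN : iid_poisson P N.
Variables (A B : 'I_q -> 'M[R]_p) (d : 'cV[R]_p).
Hypotheses (p0 : (0 < p)%N).
Hypotheses (A0 : forall i, mxle 0 (A i)) (B0 : forall i, mxle 0 (B i)).
Hypothesis d0 : mxle 0 d.
Let M : 'M[R]_p := \sum_(i < q) (A i + B i).

Lemma measurable_exp_lyapunov (v : 'rV[R]_p) (a b g : R) n t :
  measurable_fun setT (fun w =>
    expR (a * (lyapunov A B v g (history A B d (noise_of N w) n t) + b))).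
Proof.
apply: measurableT_comp => //; apply: measurable_funM => //.
apply: measurable_funD => //.
by apply: (past_measurable_measurable hN); exact: past_measurable_lyapunov.
Qed.

Lemma measurable_exp_step (v : 'rV[R]_p) (a b g : R) (c : 'I_p -> R) n t :
  measurable_fun setT (fun w => let h := history A B d (noise_of N w) n t in
    expR (a * (lyapunov A B v g h + b) + \sum_k c k * intensity A B d h k 0)).
Proof.
apply: measurableT_comp => //; apply: measurable_funD; last first.
  apply: measurable_sum => k; apply: measurable_funM => //.
  by apply: (past_measurable_measurable hN); exact: past_measurable_intensity.
apply: measurable_funM => //; apply: measurable_funD => //.
by apply: (past_measurable_measurable hN); exact: past_measurable_lyapunov.
Qed.

Lemma integral_exp_shift (v : 'rV[R]_p) (a b g : R) n t :
  (\int[P]_w (expR (a * (lyapunov A B v g (history A B d (noise_of N w) n t) + b)))%:E =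
  (expR (a * b))%:E *
  \int[P]_w (expR (a * lyapunov A B v g (history A B d (noise_of N w) n t)))%:E)%E.
Proof.
rewrite -ge0_integralZl//.
- by apply: eq_integral => w _; rewrite -EFinM -expRD mulrDr addrC.
- apply/measurable_EFinP; have := measurable_exp_lyapunov v a 0 g n t.
  by under eq_fun do rewrite addr0.
Qed.

Lemma lyapunov_history0 (v : 'rV[R]_p) g f t :
  lyapunov A B v g (history A B d f 0 t) = 0.
Proof.
rewrite /lyapunov big1// => i _; rewrite big1// => j _.
rewrite /contribution /= mulmx0 mxE add0r.
have -> : natcol (const_mx 0%N) = 0 :> 'cV[R]_p by apply/matrixP => ? ?; rewrite !mxE.
by rewrite mulmx0 mxE mulr0.
Qed.

Lemma lyap_alpha_beta1 (v : 'rV[R]_p) : lyap_alpha A v 1 + lyap_beta B v 1 = v *m M.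
Proof.
rewrite /lyap_alpha /lyap_beta /M mulmx_sumr -big_split/=.
by apply: eq_bigr => i _; rewrite !expr1n !scale1r mulmxDr.
Qed.

Lemma lyap_alpha_beta_le (v : 'rV[R]_p) (g e : R) : mxle 0 v -> 1 <= g -> 0 <= e ->
  mxle (lyap_alpha A v g + (1 + e) *: lyap_beta B v g) ((1 + e) * g ^+ q *: (v *m M)).
Proof.
move=> v0 g1 e0; rewrite /lyap_alpha /lyap_beta /M mulmx_sumr !scaler_sumr -big_split/=.
apply: mxle_sum => i k j; rewrite mulmxDr.
move: (mxge0_mul v0 (A0 i)) (mxge0_mul v0 (B0 i)).
move: (v *m A i) (v *m B i) => X Y X0 Y0; rewrite !mxE.
have a0 : 0 <= X k j by exact: mxge0E.
have b0 : 0 <= Y k j by exact: mxge0E.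
have gi : g ^+ i.+1 <= g ^+ q by rewrite ler_weXn2l.
apply: (@le_trans _ _ (g ^+ i.+1 * ((1 + e) * (X k j + Y k j)))); first last.
  rewrite mulrCA -[leRHS]mulrA; apply: ler_wpM2l; first by rewrite addr_ge0.
  by apply: ler_wpM2r => //; exact: addr_ge0.
have : 0 <= g ^+ i.+1 * (e * X k j) by rewrite !mulr_ge0 ?exprn_ge0// (le_trans ler01).
lra.
Qed.

Lemma subcritical_lyapunov (v : 'rV[R]_p) : subinvariant M 1 v ->
  exists g s0 K, [/\ 1 < g, 0 < s0 & forall s n t, 0 <= s -> s <= s0 ->
   (\int[P]_w (expR (s * lyapunov A B v g (history A B d (noise_of N w) n t)))%:E
     <= (expR (s * K))%:E)%E].
Proof.
move=> vM; have [vgt0 _] := vM.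
have v0 : mxle 0 v by apply/mxge0P => i j; rewrite (ord1 i) ltW.
have [kappa [k0 k1 vk]] := subinvariant_contraction vM.
have [g g1 gk] := expansion_rate q k0 k1.
have g0 : 0 < g := lt_trans ltr01 g1.
pose e := g - 1; have e0 : 0 < e by rewrite subr_gt0.
have [s1 s10 psi_le] := @psi_le_linear R p e p0 e0.
pose al := lyap_alpha A v g; pose be := lyap_beta B v g.
have be0 k : 0 <= be 0 k.
  apply: mxge0E; apply: mxge0_sum => i; apply/mxge0P => a b; rewrite mxE.
  rewrite mulr_ge0 ?exprn_ge0 ?(ltW g0)//.
  exact/mxge0E/mxge0_mul.
have sb0 : 0 <= \sum_k be 0 k by exact: sumr_ge0.
have ab k : al 0 k + (1 + e) * be 0 k <= v 0 k.
  have := lyap_alpha_beta_le v0 (ltW g1) (ltW e0) 0 k.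
  rewrite 3!mxE => /le_trans; apply.
  have := vk 0 k; rewrite [leRHS]mxE => h.
  have ge : 0 <= (1 + e) * g ^+ q by rewrite mulr_ge0 ?exprn_ge0//; lra.
  apply: le_trans (ler_wpM2l ge h) _; rewrite mulrA.
  by apply: ler_piMl; [exact/ltW|rewrite /e subrKC -exprS].
(* The fixed point of the recursion on bounds: (s / g) (v d + K) = s K. *)
pose K := (v *m d) 0 0 / (g - 1).
have vd0 : 0 <= (v *m d) 0 0 by exact/mxge0E/mxge0_mul.
have K0 : 0 <= K by rewrite divr_ge0// ltW.
(* Ensures (s / g) be_k <= s1, the range where [psi] is at most 1 + e times its argument. *)
exists g, (s1 / (1 + \sum_k be 0 k)), K; split=> //.
  by rewrite divr_gt0// ltr_pwDl.
move=> s n; elim: n s => [|n IH] s t s0 ss.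
  under eq_integral do rewrite lyapunov_history0 mulr0 expR0.
  by rewrite integral_cst// [X in (_ * X)%E]probability_setT mule1 lee_fin -[leLHS]expR0 ler_expR mulr_ge0.
have sg : 0 <= s / g by rewrite divr_ge0// ltW.
have sgs : s / g <= s by rewrite ler_pdivrMr// ler_peMr// ltW.
apply: le_trans (lyapunov_exp_step hN p0 A0 B0 d0 v s n t (lt0r_neq0 g0)) _.
apply: (@le_trans _ _ (\int[P]_w (expR ((s / g) *
    (lyapunov A B v g (history A B d (noise_of N w) n (t - 1)) + (v *m d) 0 0)))%:E)%E).
  apply: ge0_le_integral => //=.
  - by apply/measurable_EFinP; exact: measurable_exp_step.
  - apply/measurable_EFinP; exact: measurable_exp_lyapunov.
  (* Each coefficient of an intensity is at most (s / g) (al_k - v_k + (1 + e) be_k) <= 0, so the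
     intensities drop out. *)
  - move=> w _; rewrite lee_fin ler_expR gerDl; apply: sumr_le0 => k _.
    apply: mulr_le0_ge0; last first.
      by apply/mxge0E/(mxle_trans d0)/intensity_ge => // j; exact: history_ge0.
    have bs : s / g * be 0 k <= s1.
      apply: (@le_trans _ _ (s * (1 + \sum_k be 0 k))); last first.
        by rewrite -ler_pdivlMr// ltr_pwDl.
      apply: ler_pM => //; rewrite (bigD1 k)//= addrCA lerDl.
      by rewrite addr_ge0// sumr_ge0.
    have := psi_le _ (mulr_ge0 sg (be0 k)) bs; rewrite -/al -/be => hp.
    have := ler_wpM2l sg (ab k); lra.
rewrite integral_exp_shift.
apply: le_trans (lee_wpmul2l _ (IH (s / g) (t - 1) sg (le_trans sgs ss))) _.
  by rewrite lee_fin expR_ge0.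
rewrite -EFinM lee_fin -expRD ler_expR -mulrDr /K.
rewrite le_eqVlt; apply/orP; left; apply/eqP; field.
by rewrite gt_eqF//= gt_eqF.
Qed.

(* The exponents 1 / (c m) are chosen so that s - c s^2 >= s' for
   consecutive values s = 1 / (c m) and s' = 1 / (c (m + 2)). *)
Lemma supercritical_lyapunov (v : 'rV[R]_p) : mxle 0 v -> mxle v (v *m M) ->
  (exists2 C, 0 < C & mxle (v *m M) (C *: v)) ->
  exists2 c, 0 < c & forall n t m, 2 <= m ->
   (\int[P]_w (expR (- (c * m)^-1 *
       lyapunov A B v 1 (history A B d (noise_of N w) n t)))%:E
     <= (expR (- ((v *m d) 0 0 / c * harm2 m n)))%:E)%E.
Proof.
move=> v0 vM [C C0 MC].
have V0 : 0 <= \sum_k v 0 k by apply: sumr_ge0 => k _; exact: mxge0E.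
have pR : 0 <= p%:R :> R by [].
(* Makes p be_k^2 <= c v_k, using be_k <= C v_k and v_k <= sum of v; the 1 keeps c positive. *)
pose c := 1 + p%:R * C ^+ 2 * \sum_k v 0 k.
have c0 : 0 < c by rewrite ltr_pwDl// mulr_ge0// mulr_ge0// sqr_ge0.
pose al := lyap_alpha A v 1; pose be := lyap_beta B v 1.
have abE k : al 0 k + be 0 k = (v *m M) 0 k by rewrite -lyap_alpha_beta1 mxE.
have al0 k : 0 <= al 0 k.
  apply: mxge0E; apply: mxge0_sum => i; rewrite expr1n scale1r.
  exact/mxge0_mul.
have be0 k : 0 <= be 0 k.
  apply: mxge0E; apply: mxge0_sum => i; rewrite expr1n scale1r.
  exact/mxge0_mul.
have beC k : be 0 k <= C * v 0 k.
  have := MC 0 k; rewrite [leRHS]mxE -abE; apply: le_trans.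
  by rewrite lerDr.
have be2 k : p%:R * be 0 k ^+ 2 <= c * v 0 k.
  have vk := mxge0E 0 k v0.
  have h1 : be 0 k ^+ 2 <= (C * v 0 k) ^+ 2 by rewrite ler_sqr ?nnegrE ?mulr_ge0// ltW.
  have h2 : v 0 k <= \sum_k v 0 k by rewrite (bigD1 k)//= lerDl sumr_ge0// => j _; exact: mxge0E.
  apply: le_trans (ler_wpM2l pR h1) _; rewrite /c mulrDl mul1r exprMn.
  have := ler_wpM2l (mulr_ge0 (mulr_ge0 pR (sqr_ge0 C)) vk) h2; nra.
have vd0 : 0 <= (v *m d) 0 0 by exact/mxge0E/mxge0_mul.
exists c => // n; elim: n => [|n IH] t m m2.
  under eq_integral do rewrite lyapunov_history0 mulr0 expR0.
  rewrite integral_cst// [X in (_ * X)%E]probability_setT mule1 lee_fin.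
  by rewrite /harm2 big_ord0 mulr0 oppr0 expR0.
have m0 : 0 < m by lra.
have m20 : 0 < m + 2 by lra.
set s := (c * m)^-1; have s0 : 0 < s by rewrite invr_gt0 mulr_gt0.
pose s' := (c * (m + 2))^-1; have s'0 : 0 < s' by rewrite invr_gt0 mulr_gt0.
(* Equivalent to m^2 <= (m - 1) (m + 2), that is m >= 2. *)
have ss' : s' <= s - c * s ^+ 2.
  have -> : s - c * s ^+ 2 = (m - 1) / m ^+ 2 / c by rewrite /s; field; rewrite !gt_eqF.
  rewrite /s' invfM [_ / c]mulrC ler_pM2l ?invr_gt0//.
  rewrite ler_pdivlMr ?exprn_gt0// mulrC ler_pdivrMr//; nra.
apply: le_trans (lyapunov_exp_step hN p0 A0 B0 d0 v (- s) n t (oner_neq0 R)) _.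
apply: (@le_trans _ _ (\int[P]_w (expR (- s' *
    (lyapunov A B v 1 (history A B d (noise_of N w) n (t - 1)) + (v *m d) 0 0)))%:E)%E).
  apply: ge0_le_integral => //=.
  - by apply/measurable_EFinP; exact: measurable_exp_step.
  - apply/measurable_EFinP; exact: measurable_exp_lyapunov.
  move=> w _; rewrite lee_fin ler_expR; set h := history _ _ _ _ _ _.
  have h0 j : mxle 0 (h j).2 by exact: history_ge0.
  have l0 k : 0 <= intensity A B d h k 0.
    by apply/mxge0E/(mxle_trans d0)/intensity_ge.
  (* The second-order error c s^2 v lambda is charged to U, since v lambda is at most U + v d; this
     lowers the exponent from s to s - c s^2. *)
  have vl := intensity_le_lyapunov d A0 B0 v0 ler01 h0.
  set U := lyapunov A B v 1 h + (v *m d) 0 0 in vl *.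
  have vl0 : 0 <= (v *m intensity A B d h) 0 0.
    by apply: mxge0E; apply: mxge0_mul => //; apply: mxle_trans d0 _; exact: intensity_ge.
  have sumE : \sum_k c * s ^+ 2 * v 0 k * intensity A B d h k 0 =
      c * s ^+ 2 * (v *m intensity A B d h) 0 0.
    by rewrite row_mul_col mulr_sumr; apply: eq_bigr => k _; ring.
  have : \sum_k (- s / 1 * (al 0 k - v 0 k) + psi p (- s / 1 * be 0 k)) *
      intensity A B d h k 0 <= c * s ^+ 2 * (v *m intensity A B d h) 0 0.
    rewrite -sumE; apply: ler_sum => k _; apply: ler_wpM2r => //.
    rewrite !divr1 !mulNr.
    have := @psi_opp_le R p (s * be 0 k) p0 (mulr_ge0 (ltW s0) (be0 k)).
    have := ler_wpM2l (ltW s0) (vM 0 k); rewrite -abE.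
    have := ler_wpM2l (sqr_ge0 s) (be2 k).
    rewrite exprMn; lra.
  have := ler_wpM2l (mulr_ge0 (ltW c0) (sqr_ge0 s)) vl.
  have U0 : 0 <= U by exact: le_trans vl.
  have := ler_wpM2r U0 ss'; rewrite divr1; lra.
rewrite integral_exp_shift.
apply: le_trans (lee_wpmul2l _ (IH (t - 1) (m + 2) _)) _.
- by rewrite lee_fin expR_ge0.
- lra.
rewrite -EFinM lee_fin -expRD ler_expR harm2S /s' invfM.
rewrite le_eqVlt; apply/orP; left; apply/eqP; field.
by rewrite gt_eqF//= gt_eqF.
Qed.

End ExponentialEstimates.

(** * Almost sure statements *)

Section AlmostSure.
Context {disp : measure_display} {T : measurableType disp} {R : realType}.
Variable P : probability T R.

Lemma ae_forall_countable (I : countType) (Q : I -> T -> Prop) :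
  (forall i, {ae P, forall w, Q i w}) -> {ae P, forall w, forall i, Q i w}.
Proof.
move=> hQ; pose Q' n w := if choice.unpickle n is Some i then Q i w else True.
have : {ae P, forall w, forall n, Q' n w}.
  apply: ae_foralln => n; rewrite /Q'; case: choice.unpickle => [i|]; first exact: hQ.
  exact: aeW.
by apply: filterS => w h i; have := h (choice.pickle i); rewrite /Q' choice.pickleK.
Qed.

Lemma ae_not_false : ~ {ae P, forall w : T, False}.
Proof.
move=> [E [mE PE0 hE]]; have : P setT = 1%E by exact: probability_setT.
have ET : E = setT by apply/seteqP; split=> // w _; apply: hE.
by rewrite -ET PE0 => /eqP; rewrite eq_sym onee_eq0.
Qed.

Lemma exp_integral_gt0 (f : T -> R) : measurable_fun setT f ->
  (0 < \int[P]_w (expR (f w))%:E)%E.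
Proof.
move=> mf; rewrite lt_def integral_ge0// andbT.
apply/eqP => I0; apply: ae_not_false.
have me : measurable_fun setT (fun w => (expR (f w))%:E).
  by apply/measurable_EFinP; exact: measurableT_comp.
have : (\int[P]_w `|(expR (f w))%:E| = 0)%E.
  by rewrite -[RHS]I0; apply: eq_integral => w _; rewrite gee0_abs// lee_fin expR_ge0.
move=> /(ae_eq_integral_abs P measurableT me); apply: filterS => w /(_ I) [].
by move=> /eqP; rewrite gt_eqF// expR_gt0.
Qed.

(** The positive part h of g - f has integral 0, as the integral of f + h is at most that of g,
    equal to the finite integral of f. The maximum makes h nonnegative also on the null set where f
    <= g fails. *)
Lemma ae_eq_of_le (f g : T -> R) : measurable_fun setT f -> measurable_fun setT g ->
  (forall w, 0 <= f w) -> {ae P, forall w, f w <= g w} ->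
  (\int[P]_w (f w)%:E = \int[P]_w (g w)%:E)%E -> (\int[P]_w (g w)%:E < +oo)%E ->
  {ae P, forall w, f w = g w}.
Proof.
move=> mf mg f0 fg fgE gfin.
pose h w := Num.max (g w - f w) 0.
have h0 w : 0 <= h w by rewrite le_max lexx orbT.
have mh : measurable_fun setT h by apply: measurable_maxr => //; exact: measurable_funB.
have g0 : {ae P, forall w, 0 <= g w}.
  by apply: filterS fg => w; exact: le_trans.
have fh : (\int[P]_w (f w)%:E + \int[P]_w (h w)%:E <= \int[P]_w (f w)%:E)%E.
  have me k : measurable_fun setT k -> measurable_fun setT (fun w : T => (k w : R)%:E).
    by move=> mk; exact/measurable_EFinP.
  rewrite [leRHS]fgE -ge0_integralD//=; last 4 first.
  - by move=> w _; rewrite lee_fin.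
  - exact: me.
  - by move=> w _; rewrite lee_fin.
  - exact: me.
  have -> : (\int[P]_w (g w)%:E = \int[P]_w (Num.max (g w) 0)%:E)%E.
    apply: ae_eq_integral => //; [exact: me|apply: me; exact: measurable_maxr|].
    by apply: filterS g0 => w gw _; rewrite max_l.
  apply: ae_ge0_le_integral => //.
  - by move=> w _; rewrite lee_fin addr_ge0.
  - by apply/measurable_EFinP; exact: measurable_funD.
  - by move=> w _; rewrite lee_fin le_max lexx orbT.
  - by apply: me; exact: measurable_maxr.
  apply: filterS fg => w fgw _; rewrite lee_fin /h le_max.
  by rewrite max_l ?subr_ge0// subrKC lexx.
have ffin : (\int[P]_w (f w)%:E \is a fin_num)%E.
  rewrite ge0_fin_numE ?fgE// -fgE; apply: integral_ge0 => w _; rewrite lee_fin//.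
have h0E : (\int[P]_w `|(h w)%:E| = 0)%E.
  apply/eqP; rewrite eq_le integral_ge0// andbT.
  under eq_integral do rewrite gee0_abs ?lee_fin//.
  by move: fh; rewrite -[leRHS]adde0 leeD2lE.
have := (ae_eq_integral_abs P measurableT (proj2 (measurable_EFinP _ _) mh)).1 h0E.
move=> hae; apply: filterS2 fg hae => w fgw /(_ I) [] /eqP.
by rewrite /h max_l ?subr_ge0// subr_eq0 eq_sym => /eqP.
Qed.

End AlmostSure.

(** * Comparison of solutions with histories *)

Section Solutions.
Context {disp : measure_display} {T : measurableType disp} {R : realType}.
Variable P : probability T R.
Context {p q : nat}.
Variable N : int -> 'I_p -> R -> T -> nat.
Hypothesis hN : iid_poisson P N.
Variables (A B : 'I_q -> 'M[R]_p) (d : 'cV[R]_p).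
Hypotheses (p0 : (0 < p)%N).
Hypotheses (A0 : forall i, mxle 0 (A i)) (B0 : forall i, mxle 0 (B i)).
Hypothesis d0 : mxle 0 d.
Let M : 'M[R]_p := \sum_(i < q) (A i + B i).

Lemma noise_of_mono w t i u v : 0 <= u -> u <= v ->
  (rceval (fun u => noise_of N w (t, (i, u))) u <=
   rceval (fun u => noise_of N w (t, (i, u))) v)%N.
Proof.
move=> u0 uv; rewrite /noise_of /= !(iid_poissonE hN)//; last exact: le_trans uv.
by case: hN => /(_ t i)[_ _ hm _ _ _] _ _; exact: hm.
Qed.

Lemma history_mono w n m t j : (n <= m)%N ->
  state_le (history A B d (noise_of N w) n t j) (history A B d (noise_of N w) m t j).
Proof.
move=> nm; rewrite -(subnK nm); elim: (m - n)%N => [|k [IH1 IH2]].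
  exact: state_leS.
have [h1 h2] := history_le A0 B0 d0 (@noise_of_mono w) (k + n) t j.
by split=> [i|]; [exact: leq_trans (h1 i)|exact: mxle_trans h2].
Qed.

Lemma solution_intensity Y lam : is_solution P A B d N Y lam ->
  {ae P, forall w, forall t,
    (forall i, Y t w i 0 = N t i (lam t w i 0) w) /\
    lam t w = intensity A B d (fun j => (Y (t - j.+1%:Z) w, lam (t - j.+1%:Z) w))}.
Proof.
move=> [_ _ _ hY hl]; apply: ae_forall_countable => t.
apply: filterS2 (hY t) (hl t) => w Yw lw; split; last exact: lw.
by move=> i; rewrite Yw mxE.
Qed.

(** Times being countable, the equations hold for all of them outside one null set, and the pathwise
    comparison applies there. *)
Lemma solution_ge_history Y lam : is_solution P A B d N Y lam ->
  {ae P, forall w, forall n t j, state_le (history A B d (noise_of N w) n t j)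
    (Y (t - j%:Z) w, lam (t - j%:Z) w)}.
Proof.
move=> sol; have [_ _ lam0 _ _] := sol.
apply: filterS (solution_intensity sol) => w hw n t j.
apply: (history_le_solution A0 B0 d0 (@noise_of_mono w) (X := fun t => (Y t w, lam t w))).
- by move=> s /=; apply/mxge0P => i k; rewrite (ord1 k).
- by move=> s i /=; rewrite /noise_of (iid_poissonE hN)//; have [->] := hw s.
- by move=> s /=; have [_] := hw s.
Qed.

Lemma supercritical_no_solution (v : 'rV[R]_p) Y lam :
  mxle 0 v -> mxle v (v *m M) -> (exists2 C, 0 < C & mxle (v *m M) (C *: v)) ->
  0 < (v *m d) 0 0 -> ~ is_solution P A B d N Y lam.
Proof.
move=> v0 vM MC vd sol; have [mY ml lam0 _ _] := sol.
have [c c0 hc] := supercritical_lyapunov hN p0 A0 B0 d0 v0 vM MC.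
pose s := (c * 2)^-1; have s0 : 0 < s by rewrite invr_gt0 mulr_gt0.
pose U w := lyapunov A B v 1 (fun j => (Y (0 - j%:Z) w, lam (0 - j%:Z) w)).
have mU : measurable_fun setT (fun w => - s * U w).
  apply: measurable_funM => //; apply: measurable_lyapunov => j i /=.
    exact: mY.
  exact: ml.
have := exp_integral_gt0 P mU.
have hI n : (\int[P]_w (expR (- s * U w))%:E <=
    (expR (- ((v *m d) 0 0 / c * harm2 2 n)))%:E)%E.
  apply: le_trans (hc n 0 2 (lexx _)).
  apply: ae_ge0_le_integral => //.
  - by apply/measurable_EFinP; exact: measurableT_comp.
  - apply/measurable_EFinP.
    have := measurable_exp_lyapunov hN A B d v (- (c * 2)^-1) 0 1 n 0.
    by under eq_fun do rewrite addr0.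
  - apply: filterS (solution_ge_history sol) => w hw _.
    rewrite lee_fin ler_expR !mulNr lerN2 ler_pM2l//.
    by apply: lyapunov_le => // j; exact: hw.
set I := (\int[P]_w _)%E in hI *; move=> I0.
have Ifin : I \is a fin_num.
  by rewrite ge0_fin_numE ?(ltW I0)//; apply: le_lt_trans (hI 0%N) _; rewrite ltry.
have fI0 : 0 < fine I by rewrite fine_gt0// I0 ltey_eq Ifin.
(* The number of steps after which the upper bound falls below the positive number [I]. *)
have [n] := harm2_unbounded (- ln (fine I) * c / (v *m d) 0 0).
rewrite ltr_pdivrMr// => hn.
have := hI n; rewrite -(fineK Ifin) lee_fin.
apply/negP; rewrite -ltNge -[ltRHS]lnK ?posrE// ltr_expR ltrNl.
by rewrite mulrAC ltr_pdivlMr// [ltRHS]mulrC.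
Qed.

End Solutions.

(** * The minimal solution *)

Section MonotoneLimits.
Context {R : realType}.

(* Zero when the sequence is unbounded. *)
Definition lsup (u : nat -> R) : R := fine (ereal_sup (range (fun n => (u n)%:E))).

Lemma lsup_ge0 u : 0 <= u 0%N -> 0 <= lsup u.
Proof.
move=> u0; apply: fine_ge0; apply: (@le_trans _ _ (u 0%N)%:E); first by rewrite lee_fin.
by apply: ereal_sup_ubound; exists 0%N.
Qed.

Lemma lsup_cvg u C : nondecreasing_seq u -> (forall n, u n <= C) -> u @ \oo --> lsup u.
Proof.
move=> uI uC.
have h : (fun n => (u n)%:E) @ \oo --> ereal_sup (range (fun n => (u n)%:E)).
  by apply: ereal_nondecreasing_cvgn => n m nm; rewrite lee_fin; exact: uI.
have sfin : ereal_sup (range (fun n => (u n)%:E)) \is a fin_num.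
  rewrite fin_numE; apply/andP; split.
    rewrite gt_eqF// (@lt_le_trans _ _ (u 0%N)%:E) ?ltNyr//.
    by apply: ereal_sup_ubound; exists 0%N.
  rewrite lt_eqF// (@le_lt_trans _ _ C%:E) ?ltry//.
  by apply: ge_ereal_sup => _ [n _ <-]; rewrite lee_fin.
by move: h; rewrite -[ereal_sup _](fineK sfin) => /fine_cvg.
Qed.

Lemma le_lsup u C n : nondecreasing_seq u -> (forall n, u n <= C) -> u n <= lsup u.
Proof.
move=> uI uC; have uS := lsup_cvg uI uC.
rewrite -(cvg_lim _ uS)//; apply: nondecreasing_cvgn_le => //.
by apply/cvg_ex; exists (lsup u).
Qed.

Lemma lsup_le u C : nondecreasing_seq u -> (forall n, u n <= C) -> lsup u <= C.
Proof.
move=> uI uC; have uS := lsup_cvg uI uC.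
rewrite -(cvg_lim _ uS)//; apply: limr_le; first by apply/cvg_ex; exists (lsup u).
exact: nearW.
Qed.

Lemma measurable_lsup d (W : measurableType d) (u : nat -> W -> R) :
  (forall n, measurable_fun setT (u n)) -> measurable_fun setT (fun w => lsup (u ^~ w)).
Proof.
move=> mu; apply: measurableT_comp => //.
have := @measurable_fun_esups _ W R setT (fun n w => (u n w)%:E)
  (fun n => proj2 (measurable_EFinP _ _) (mu n)) 0%N.
congr measurable_fun; apply/funext => w; rewrite /esups/= /sdrop; congr ereal_sup.
by apply/seteqP; split=> x [n _ <-]; exists n.
Qed.

Context {disp : measure_display} {T : measurableType disp}.
Variable P : probability T R.

(** The limit is real-valued and identified only almost everywhere, as for [lsup], which takes a
    default value on unbounded paths. *)
Lemma ae_monotone_convergence (f : nat -> T -> R) (F : T -> R) :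
  (forall n, measurable_fun setT (f n)) -> measurable_fun setT F ->
  (forall n w, 0 <= f n w) -> (forall w, 0 <= F w) ->
  (forall w, nondecreasing_seq (f ^~ w)) ->
  {ae P, forall w, f n w @[n --> \oo] --> F w} ->
  ((fun n => \int[P]_w (f n w)%:E) @ \oo --> \int[P]_w (F w)%:E)%E.
Proof.
move=> mf mF f0 F0 fI fF.
have me n : measurable_fun setT (fun w => (f n w)%:E) by exact/measurable_EFinP.
have nd w : {homo (fun n => (f n w)%:E) : n m / (n <= m)%N >-> (n <= m)%E}.
  by move=> n m nm; rewrite lee_fin; exact: fI.
have -> : (\int[P]_w (F w)%:E = \int[P]_w limn (fun n => (f n w)%:E))%E.
  apply: ge0_ae_eq_integral => //.
  - exact/measurable_EFinP.
  - by apply: (emeasurable_fun_cvg (fun n w => (f n w)%:E)) => // w _; exact: ereal_nondecreasing_is_cvgn.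
  - by move=> w _; rewrite lee_fin.
  - move=> w _; apply: lime_ge; first exact: ereal_nondecreasing_is_cvgn.
    by apply: nearW => n; rewrite lee_fin.
  - apply: filterS fF => w fw _; apply/esym/cvg_lim => //.
    by apply: cvg_EFin; [exact: nearW|exact: fw].
apply: cvg_monotone_convergence => //.
by move=> n w _; rewrite lee_fin.
Qed.

(** The increasing limit has integral at most K, so it is almost everywhere finite. *)
Lemma ae_bounded_of_integral (f : nat -> T -> R) (K : R) :
  (forall n, measurable_fun setT (f n)) -> (forall n w, 0 <= f n w) ->
  (forall w, nondecreasing_seq (f ^~ w)) ->
  (forall n, (\int[P]_w (f n w)%:E <= K%:E)%E) ->
  {ae P, forall w, exists C, forall n, f n w <= C}.
Proof.
move=> mf f0 fI fK.
have me n : measurable_fun setT (fun w => (f n w)%:E) by exact/measurable_EFinP.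
have nd w : {homo (fun n => (f n w)%:E) : n m / (n <= m)%N >-> (n <= m)%E}.
  by move=> n m nm; rewrite lee_fin; exact: fI.
pose G w := limn (fun n => (f n w)%:E).
have Gc w : (fun n => (f n w)%:E) @ \oo --> G w by exact: ereal_nondecreasing_is_cvgn.
have G0 w : (0 <= G w)%E.
  apply: lime_ge; first exact: ereal_nondecreasing_is_cvgn.
  by apply: nearW => n; rewrite lee_fin.
have mG : measurable_fun setT G by exact: (emeasurable_fun_cvg (fun n w => (f n w)%:E)).
have iG : (\int[P]_w G w <= K%:E)%E.
  have hG := @cvg_monotone_convergence _ _ _ P _ measurableT _ me
    (fun n w _ => f0 n w) (fun w _ => nd w).
  rewrite -(cvg_lim _ hG)//; apply: lime_le; first by apply/cvg_ex; eexists; exact: hG.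
  exact: nearW.
have intG : P.-integrable setT G.
  apply/integrableP; split=> //; under eq_integral do rewrite gee0_abs//.
  by apply: le_lt_trans iG _; rewrite ltry.
apply: filterS (integrable_ae measurableT intG) => w /(_ I) Gfin.
exists (fine (G w)) => n; rewrite -lee_fin fineK//.
have -> : G w = ereal_sup (range (fun n => (f n w)%:E)).
  exact: cvg_lim (ereal_nondecreasing_cvgn (nd w)).
by apply: ereal_sup_ubound; exists n.
Qed.

End MonotoneLimits.

Section MinimalSolution.
Context {R : realType} {p q : nat}.
Variables (A B : 'I_q -> 'M[R]_p) (d : 'cV[R]_p).

(** Defined on every noise path, so that it commutes with time shifts everywhere and not only almost
    surely. *)
Definition lam_min (f : noise) (t : int) : 'cV[R]_p :=
  \col_i lsup (fun n => (history A B d f n t 0).2 i 0).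

(* Not the limit of the counts of the histories, with which it agrees almost
   surely only, but the count at the limit intensity. *)
Definition Y_min (f : noise) (t : int) : 'cV[nat]_p :=
  \col_i rceval (fun u => f (t, (i, u))) (lam_min f t i 0).

Lemma lam_min_shift f t h :
  lam_min (fun k => f (k.1 + h, k.2)) t = lam_min f (t + h).
Proof.
apply/colP => i; rewrite !mxE; congr lsup; apply/funext => n.
by rewrite history_shift.
Qed.

Lemma Y_min_shift f t h : Y_min (fun k => f (k.1 + h, k.2)) t = Y_min f (t + h).
Proof. by apply/colP => i; rewrite mxE [RHS]mxE lam_min_shift. Qed.

Lemma lam_min_ge0 f t i : 0 <= lam_min f t i 0.
Proof. by rewrite mxE; apply: lsup_ge0; rewrite mxE. Qed.

Lemma measurable_lam_min dW (W : measurableType dW) (f : W -> noise) t :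
  (forall s i u, s <= t - 1 -> 0 <= u -> measurable_fun setT (fun w => f w (s, (i, u)))) ->
  forall i, measurable_fun setT (fun w => lam_min (f w) t i 0).
Proof.
move=> mf i; under eq_fun do rewrite mxE.
apply: (measurable_lsup (u := fun n w => (history A B d (f w) n t 0).2 i 0)).
case=> [|n] /=; first exact: measurable_cst.
have mh := measurable_history A B d n mf.
by apply: measurable_intensity => j k; have [] := mh j k.
Qed.

Lemma measurable_Y_min dW (W : measurableType dW) (f : W -> noise) t :
  (forall s i u, s <= t -> 0 <= u -> measurable_fun setT (fun w => f w (s, (i, u)))) ->
  forall i, measurable_fun setT (fun w => Y_min (f w) t i 0).
Proof.
move=> mf i; under eq_fun do rewrite mxE.
apply: (measurable_rceval (X := fun u w => f w (t, (i, u)))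
  (L := fun w => lam_min (f w) t i 0)) => [u u0|]; first exact: mf.
apply: measurable_lam_min => s k u st; apply: mf.
by apply: le_trans st _; rewrite gerDl.
Qed.

Lemma cvg_intensity (h : nat -> nat -> state) (h' : nat -> state) :
  (forall j i, ((h n j).1 i 0)%:R @[n --> \oo] --> (((h' j).1 i 0)%:R : R)) ->
  (forall j i, (h n j).2 i 0 @[n --> \oo] --> (h' j).2 i 0) ->
  forall i, intensity A B d (h n) i 0 @[n --> \oo] --> intensity A B d h' i 0.
Proof.
move=> h1 h2 i; rewrite intensity_entry.
under eq_fun do rewrite intensity_entry.
have cvg_ssum (F : 'I_q -> 'I_p -> nat -> R) F' :
   (forall k j, F k j n @[n --> \oo] --> F' k j) ->
   \sum_k \sum_j F k j n @[n --> \oo] --> \sum_k \sum_j F' k j.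
  move=> hF; apply: (@cvg_big R _ +%R 0 xpredT add_continuous) => k _.
  by apply: (@cvg_big R _ +%R 0 xpredT add_continuous) => j _; exact: hF.
apply: cvgD; first apply: cvgD; first exact: cvg_cst.
- by apply: cvg_ssum => k j; apply: cvgMr; exact: h2.
- by apply: cvg_ssum => k j; apply: cvgMr; exact: h1.
Qed.

End MinimalSolution.

Section Existence.
Context {disp : measure_display} {T : measurableType disp} {R : realType}.
Variable P : probability T R.
Context {p q : nat}.
Variable N : int -> 'I_p -> R -> T -> nat.
Hypothesis hN : iid_poisson P N.
Variables (A B : 'I_q -> 'M[R]_p) (d : 'cV[R]_p).
Hypotheses (p0 : (0 < p)%N).
Hypotheses (A0 : forall i, mxle 0 (A i)) (B0 : forall i, mxle 0 (B i)).
Hypothesis d0 : mxle 0 d.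
Let M : 'M[R]_p := \sum_(i < q) (A i + B i).
Variable v : 'rV[R]_p.
Hypothesis vM : subinvariant M 1 v.

Let hist n t w := history A B d (noise_of N w) n t.

Lemma history_intensity_nondecreasing t i w :
  nondecreasing_seq (fun n => (hist n t w 0).2 i 0).
Proof. by move=> n m nm; have [_] := history_mono hN A0 B0 d0 w t 0 nm; exact. Qed.

Lemma measurable_hist n t i : measurable_fun setT (fun w => (hist n t w 0).2 i 0).
Proof.
apply: (past_measurable_measurable hN (t := t)).
by have [] := @past_measurable_history _ _ _ _ _ N A B d n t 0 i.
Qed.

Lemma history_exp_moment : exists2 delta, 0 < delta & exists K, forall n t,
  (\int[P]_w (expR (delta * \sum_i (hist n t w 0).2 i 0))%:E <= K%:E)%E.
Proof.
have [g [s0 [K [g1 s00 hK]]]] := subcritical_lyapunov hN p0 A0 B0 d0 vM.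
have [v0 _] := vM.
have S0 : 0 < \sum_i (v 0 i)^-1.
  rewrite (bigD1 (Ordinal p0))//= ltr_pwDl ?invr_gt0//.
  by apply: sumr_ge0 => i _; rewrite invr_ge0 ltW.
(* A positive lower bound for the entries of [v], turning a bound on v lambda into one on the sum of
   the intensities. *)
pose m := (\sum_i (v 0 i)^-1)^-1.
have m0 : 0 < m by rewrite invr_gt0.
have mv i : m <= v 0 i.
  rewrite /m invf_ple ?posrE// (bigD1 i)//= lerDl.
  by apply: sumr_ge0 => j _; rewrite invr_ge0 ltW.
have v0' : mxle 0 v by move=> i j; rewrite (ord1 i) mxE ltW.
exists (s0 * m); first exact: mulr_gt0.
(* The 1 covers n = 0, where the history vanishes and the integral is 1. *)
exists (expR (s0 * (v *m d) 0 0) * expR (s0 * K) + 1) => -[|n] t.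
  under eq_integral => w _.
    rewrite (eq_bigr (fun=> 0)) => [|i _]; last by rewrite /hist /= mxE.
    rewrite sumr_const mul0rn mulr0 expR0; over.
  rewrite integral_cst// [X in (_ * X)%E]probability_setT mule1 lee_fin.
  by rewrite lerDr mulr_ge0// expR_ge0.
apply: (@le_trans _ _ (\int[P]_w (expR (s0 *
    (lyapunov A B v g (hist n (t - 1) w) + (v *m d) 0 0)))%:E)%E).
  apply: ge0_le_integral => //.
  - apply/measurable_EFinP; apply: measurableT_comp => //.
    apply: measurable_funM => //; apply: measurable_sum => i.
    exact: (measurable_hist n.+1 t i).
  - by apply/measurable_EFinP; exact: (measurable_exp_lyapunov hN).
  move=> w _; rewrite lee_fin ler_expR -mulrA ler_pM2l//.
  have h0 j : mxle 0 (hist n (t - 1) w j).2 by exact: history_ge0.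
  apply: le_trans (intensity_le_lyapunov d A0 B0 v0' (le_trans ler01 (ltW g1)) h0).
  rewrite row_mul_col mulr_sumr; apply: ler_sum => i _; apply: ler_wpM2r => //.
  by apply/mxge0E/(mxle_trans d0)/intensity_ge.
rewrite (integral_exp_shift hN).
have := lee_wpmul2l _ (hK s0 n (t - 1) (ltW s00) (lexx _)).
move=> /(_ (expR (s0 * (v *m d) 0 0))%:E) h; apply: le_trans (h _) _.
  by rewrite lee_fin expR_ge0.
by rewrite -EFinM lee_fin lerDl.
Qed.

Let lamN t w := lam_min A B d (noise_of N w) t.
Let YN t w := Y_min A B d (noise_of N w) t.

Lemma history_bounded t :
  {ae P, forall w, exists C, forall n i, (hist n t w 0).2 i 0 <= C}.
Proof.
have [dl dl0 [K hK]] := history_exp_moment.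
have h0 n w i : 0 <= (hist n t w 0).2 i 0 by apply: mxge0E; exact: history_ge0.
have := @ae_bounded_of_integral _ _ _ P
  (fun n w => expR (dl * \sum_i (hist n t w 0).2 i 0)) K.
move=> /(_ _ _ _ _)/filterS; apply.
- move=> w [C hC]; exists (C / dl) => n i; rewrite ler_pdivlMr//.
  apply: le_trans (hC n); apply: (@le_trans _ _ (dl * \sum_i (hist n t w 0).2 i 0)).
    rewrite mulrC ler_pM2l// (bigD1 i)//= lerDl.
    by apply: sumr_ge0 => j _.
  by apply: le_trans (expR_ge1Dx _); rewrite lerDr.
- move=> n; apply: measurableT_comp => //; apply: measurable_funM => //.
  by apply: measurable_sum => i; exact: measurable_hist.
- by move=> n w; exact: expR_ge0.
- move=> w n m nm; rewrite ler_expR ler_pM2l//; apply: ler_sum => i _.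
  exact: history_intensity_nondecreasing.
- by move=> n; exact: hK.
Qed.

Lemma history_lam_cvg t : {ae P, forall w, forall i,
  (hist n t w 0).2 i 0 @[n --> \oo] --> lamN t w i 0 /\
  forall n, (hist n t w 0).2 i 0 <= lamN t w i 0}.
Proof.
apply: filterS (history_bounded t) => w [C hC] i; rewrite /lamN mxE.
have hI := @history_intensity_nondecreasing t i w.
by split=> [|n]; [exact: lsup_cvg hI _|exact: le_lsup hI _].
Qed.

Lemma past_measurable_lam_min t i : past_measurable N (t - 1) (fun w => lamN t w i 0).
Proof.
rewrite /lamN; apply: (@measurable_lam_min _ _ _ A B d _ (g_sigma_algebraType (past_gen N (t - 1)))
  (noise_of N) t) => s k u; exact: past_measurable_noise.
Qed.

Lemma past_measurable_Y_min t i : past_measurable N t (fun w => YN t w i 0).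
Proof.
rewrite /YN; apply: (@measurable_Y_min _ _ _ A B d _ (g_sigma_algebraType (past_gen N t))
  (noise_of N) t) => s k u; exact: past_measurable_noise.
Qed.

Lemma Y_minE t w i : YN t w i 0 = N t i (lamN t w i 0) w.
Proof. by rewrite /YN mxE (iid_poissonE hN)// lam_min_ge0. Qed.

Lemma measurable_lam_min_process t i : measurable_fun setT (fun w => lamN t w i 0).
Proof. by apply: (past_measurable_measurable hN); exact: past_measurable_lam_min. Qed.

Lemma lam_min_exp_moment : exists2 delta, 0 < delta & exists K, forall t,
  (\int[P]_w (expR (delta * \sum_i lamN t w i 0))%:E <= K%:E)%E.
Proof.
have [dl dl0 [K hK]] := history_exp_moment.
exists dl => //; exists K => t.
have hm n : measurable_fun setT (fun w => expR (dl * \sum_i (hist n t w 0).2 i 0)).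
  apply: measurableT_comp => //; apply: measurable_funM => //.
  by apply: measurable_sum => i; exact: measurable_hist.
have hl : measurable_fun setT (fun w => expR (dl * \sum_i lamN t w i 0)).
  apply: measurableT_comp => //; apply: measurable_funM => //.
  by apply: measurable_sum => i; exact: measurable_lam_min_process.
have hc := @ae_monotone_convergence _ _ _ P _ _ hm hl
  (fun n w => expR_ge0 _) (fun w => expR_ge0 _).
have {hc} : ((fun n => \int[P]_w (expR (dl * \sum_i (hist n t w 0).2 i 0))%:E) @ \oo -->
    \int[P]_w (expR (dl * \sum_i lamN t w i 0))%:E)%E.
  apply: hc.
  - move=> w n m nm; rewrite ler_expR ler_pM2l//; apply: ler_sum => i _.
    exact: history_intensity_nondecreasing.
  - apply: filterS (history_lam_cvg t) => w hw.
    have hs : dl * \sum_i (hist n t w 0).2 i 0 @[n --> \oo] -->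
        dl * \sum_i lamN t w i 0.
      apply: cvgMr; apply: (@cvg_big R _ +%R 0 xpredT add_continuous) => i _.
      by have [] := hw i.
    exact: (cvg_comp _ _ hs (@continuous_expR R _)).
move=> hc; rewrite -(cvg_lim _ hc)//; apply: lime_le; last exact: nearW.
by apply/cvg_ex; eexists; exact: hc.
Qed.

Lemma lam_min_integral_fin t i : (\int[P]_w (lamN t w i 0)%:E < +oo)%E.
Proof.
have [dl dl0 [K /(_ t) hK]] := lam_min_exp_moment.
have ml := measurable_lam_min_process.
apply: (@le_lt_trans _ _ (\int[P]_w ((dl^-1)%:E * (expR (dl * \sum_i lamN t w i 0))%:E))%E).
  apply: ge0_le_integral => //=.
  - by move=> w _; rewrite lee_fin lam_min_ge0.
  - exact/measurable_EFinP.
  - apply/measurable_EFinP; apply: measurable_funM => //; apply: measurableT_comp => //.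
    by apply: measurable_funM => //; exact: measurable_sum.
  move=> w _; rewrite lee_fin mulrC ler_pdivlMr// mulrC.
  apply: (@le_trans _ _ (dl * \sum_i lamN t w i 0)).
    rewrite ler_pM2l// (bigD1 i)//= lerDl.
    by apply: sumr_ge0 => j _; exact: lam_min_ge0.
  by apply: le_trans (expR_ge1Dx _); rewrite lerDr.
rewrite ge0_integralZl//.
- apply: (@le_lt_trans _ _ ((dl^-1)%:E * K%:E)%E); last by rewrite -EFinM ltry.
  by apply: lee_wpmul2l => //; rewrite lee_fin invr_ge0 ltW.
- apply/measurable_EFinP; apply: measurableT_comp => //.
  by apply: measurable_funM => //; exact: measurable_sum.
- by rewrite lee_fin invr_ge0 ltW.
Qed.

Lemma Y_min_integral t i :
  (\int[P]_w ((YN t w i 0)%:R : R)%:E = \int[P]_w (lamN t w i 0)%:E)%E.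
Proof.
under eq_integral do rewrite Y_minE.
apply: (predictable_mean hN); first exact: past_measurable_lam_min.
by move=> w; exact: lam_min_ge0.
Qed.

Lemma history_count_nondecreasing t i w :
  nondecreasing_seq (fun n => ((hist n t w 0).1 i 0)%:R : R).
Proof.
by move=> n m nm; rewrite ler_nat; have [h _] := history_mono hN A0 B0 d0 w t 0 nm; exact: h.
Qed.

Lemma history_count_integral n t i :
  (\int[P]_w (((hist n t w 0).1 i 0)%:R : R)%:E = \int[P]_w ((hist n t w 0).2 i 0)%:E)%E.
Proof.
case: n => [|n].
  by apply: eq_integral => w _; rewrite /hist /= !mxE.
pose L w := intensity A B d (hist n (t - 1) w) i 0.
have L0 w : 0 <= L w.
  by apply/mxge0E/(mxle_trans d0)/intensity_ge => // j; exact: history_ge0.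
rewrite -[RHS](predictable_mean hN (t := t) i (L := L))//.
  by apply: eq_integral => w _; rewrite /hist /= mxE (iid_poissonE hN)//; exact: L0.
exact: past_measurable_intensity.
Qed.

(* Both sides have the same finite mean because the expected counts of the
   histories are their expected intensities. *)
Lemma history_count_cvg t : {ae P, forall w, forall i,
  ((hist n t w 0).1 i 0)%:R @[n --> \oo] --> ((YN t w i 0)%:R : R)}.
Proof.
apply: ae_forall_countable => i.
have hle : {ae P, forall w, forall n, ((hist n t w 0).1 i 0)%:R <= ((YN t w i 0)%:R : R)}.
  apply: filterS (history_lam_cvg t) => w /(_ i)[_ hw] [|n].
    by rewrite /hist /= mxE.
  rewrite ler_nat Y_minE -(iid_poissonE hN) ?lam_min_ge0// /hist /= mxE.
  apply: (noise_of_mono hN); last exact: (hw n.+1).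
  by apply/mxge0E/(mxle_trans d0)/intensity_ge => // j; exact: history_ge0.
(* The limit of the counts of the histories: pathwise it could stay below the count at [lamN] if the
   path jumps exactly there. *)
pose F w := lsup (fun n => ((hist n t w 0).1 i 0)%:R : R).
have mc n : measurable_fun setT (fun w => ((hist n t w 0).1 i 0)%:R : R).
  have h : measurable_fun setT (fun w => (hist n t w 0).1 i 0).
    apply: (past_measurable_measurable hN (t := t)).
    by have [] := @past_measurable_history _ _ _ _ _ N A B d n t 0 i.
  exact: measurableT_comp h.
have mF : measurable_fun setT F by exact: measurable_lsup.
have mYR : measurable_fun setT (fun w => (YN t w i 0)%:R : R).
  have h : measurable_fun setT (fun w => YN t w i 0).
    by apply: (past_measurable_measurable hN); exact: past_measurable_Y_min.
  exact: measurableT_comp h.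
have F0 w : 0 <= F w by apply: lsup_ge0.
have cF : {ae P, forall w, ((hist n t w 0).1 i 0)%:R @[n --> \oo] --> F w}.
  apply: filterS hle => w hw.
  by apply: lsup_cvg; [exact: history_count_nondecreasing|exact: hw].
have hc := @ae_monotone_convergence _ _ _ P _ _ mc mF (fun n w => ler0n _ _) F0
  (fun w => @history_count_nondecreasing t i w) cF.
have hl : ((fun n => \int[P]_w ((hist n t w 0).2 i 0)%:E) @ \oo -->
    \int[P]_w (lamN t w i 0)%:E)%E.
  apply: ae_monotone_convergence.
  - by move=> n; exact: measurable_hist.
  - exact: measurable_lam_min_process.
  - by move=> n w; apply: mxge0E; exact: history_ge0.
  - by move=> w; exact: lam_min_ge0.
  - by move=> w; exact: history_intensity_nondecreasing.
  - by apply: filterS (history_lam_cvg t) => w /(_ i)[].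
have FY : (\int[P]_w (F w)%:E = \int[P]_w ((YN t w i 0)%:R : R)%:E)%E.
  rewrite Y_min_integral; rewrite -(cvg_lim _ hc)// -(cvg_lim _ hl)//.
  by congr (limn _); apply/funext => n; exact: history_count_integral.
have : {ae P, forall w, F w = (YN t w i 0)%:R}.
  apply: ae_eq_of_le => //; last by rewrite Y_min_integral lam_min_integral_fin.
  apply: filterS hle => w hw.
  by apply: lsup_le; [exact: history_count_nondecreasing|exact: hw].
by apply: filterS2 cF => w cw <-.
Qed.

Lemma lam_min_equation : {ae P, forall w, forall t,
  lamN t w = intensity A B d (fun j => (YN (t - j.+1%:Z) w, lamN (t - j.+1%:Z) w))}.
Proof.
have hall : {ae P, forall w, forall t, (forall i,
    ((hist n t w 0).1 i 0)%:R @[n --> \oo] --> ((YN t w i 0)%:R : R)) /\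
    forall i, (hist n t w 0).2 i 0 @[n --> \oo] --> lamN t w i 0}.
  apply: ae_forall_countable => t.
  apply: filterS2 (history_count_cvg t) (history_lam_cvg t) => w h1 h2.
  by split=> // i; have [] := h2 i.
apply: filterS hall => w hw t; apply/colP => i.
have h1 : (hist n.+1 t w 0).2 i 0 @[n --> \oo] --> lamN t w i 0.
  have := (hw t).2 i; rewrite -(cvg_shiftn 1).
  by under eq_fun do rewrite addn1.
(* Earlier states of a history end shorter histories, so their limits are known after shifting n by
   j. *)
have lag n j : hist n (t - 1) w j = hist (n - j) (t - j.+1%:Z) w 0.
  by rewrite /hist history_lag -addrA -opprD intS.
have h2 : intensity A B d (hist n (t - 1) w) i 0 @[n --> \oo] -->
    intensity A B d (fun j => (YN (t - j.+1%:Z) w, lamN (t - j.+1%:Z) w)) i 0.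
  apply: cvg_intensity => j k /=.
    rewrite -(cvg_shiftn j); under eq_fun do rewrite lag addnK.
    exact: (hw (t - j.+1%:Z)).1.
  rewrite -(cvg_shiftn j); under eq_fun do rewrite lag addnK.
  exact: (hw (t - j.+1%:Z)).2.
exact: cvg_unique h1 h2.
Qed.

End Existence.

(** * Stationary non-anticipative solutions *)

Section GoodSolutions.
Context {disp : measure_display} {T : measurableType disp} {R : realType}.
Variable P : probability T R.
Context {p q : nat}.
Variable N : int -> 'I_p -> R -> T -> nat.
Hypothesis hN : iid_poisson P N.
Variables (A B : 'I_q -> 'M[R]_p) (d : 'cV[R]_p).
Hypotheses (p0 : (0 < p)%N).
Hypotheses (A0 : forall i, mxle 0 (A i)) (B0 : forall i, mxle 0 (B i)).
Hypothesis d0 : mxle 0 d.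
Let M : 'M[R]_p := \sum_(i < q) (A i + B i).

Lemma past_measurable_mono s t d' (S : measurableType d') (f : T -> S) :
  s <= t -> past_measurable N s f -> past_measurable N t f.
Proof.
move=> st mf _ C mC; have := mf measurableT C mC.
apply: sub_sigma_algebra2 => E [[r [i u]] /= [rs u0] hE].
by exists (r, (i, u)) => //=; split=> //; exact: le_trans st.
Qed.

Section NonAnticipative.
Variables (Y : int -> T -> 'cV[nat]_p) (lam : int -> T -> 'cV[R]_p).

Lemma non_anticipativeP : non_anticipative N Y lam <->
  forall t i, past_measurable N t (fun w => Y t w i 0) /\
              past_measurable N t (fun w => lam t w i 0).
Proof.
split=> [na t i|h t].
  split=> _ C mC; apply: na; apply: sub_sigma_algebra; exists i => //.
    exists (C `*` setT); first exact: measurableX.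
    by rewrite !setTI; apply/seteqP; split=> w //= [].
  exists (setT `*` C); first exact: measurableX.
  by rewrite !setTI; apply/seteqP; split=> w //= [].
apply: smallest_sub; first exact: (@sigma_algebra_measurable _ (g_sigma_algebraType (past_gen N t))).
move=> E [i _ [C mC <-]]; have [hY hl] := h t i.
exact: (measurable_fun_pair hY hl) measurableT C mC.
Qed.

End NonAnticipative.

Section StationaryMean.
Variables (Y : int -> T -> 'cV[nat]_p) (lam : int -> T -> 'cV[R]_p).
Hypotheses (sol : is_solution P A B d N Y lam) (st : stationary P Y lam).

Lemma stationary_mean t i :
  (\int[P]_w (lam t w i 0)%:E = \int[P]_w (lam 0 w i 0)%:E)%E.
Proof.
have [_ ml l0 _ _] := sol.
pose X s := as_mfun (ml s i).
(* The absolute value makes the integrand nonnegative on the whole line and changes nothing at the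
   nonnegative values of [lam]. *)
have XE s : (\int[P]_w (lam s w i 0)%:E = \int[distribution P (X s)]_x `|x|%:E)%E.
  rewrite ge0_integral_distribution//=.
    by apply: eq_integral => w _ /=; rewrite ger0_norm//; exact: l0.
  by apply/measurable_EFinP; exact: normr_measurable.
rewrite !XE; apply: eq_measure_integral => C mC _.
have := @st t [set f | C (f (0, i)).2]; rewrite /coords/= add0r; apply.
apply: sub_sigma_algebra; exists (0, i) => //; exists (setT `*` C).
  exact: measurableX.
by rewrite setTI; apply/seteqP; split=> f //= [].
Qed.

End StationaryMean.

Lemma integral_intensity (h : T -> nat -> state) (x : 'cV[R]_p) i :
  (forall j k, measurable_fun setT (fun w => (h w j).1 k 0)) ->
  (forall j k, measurable_fun setT (fun w => (h w j).2 k 0)) ->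
  (forall w j k, 0 <= (h w j).2 k 0) ->
  (forall j k, \int[P]_w (((h w j).1 k 0)%:R : R)%:E = (x k 0)%:E)%E ->
  (forall j k, \int[P]_w ((h w j).2 k 0)%:E = (x k 0)%:E)%E ->
  (\int[P]_w (intensity A B d (h w) i 0)%:E = ((d + M *m x) i 0)%:E)%E.
Proof.
move=> m1 m2 h0 e1 e2.
have a0 k j : 0 <= A k i j by exact: mxge0E.
have b0 k j : 0 <= B k i j by exact: mxge0E.
have m1' j k : measurable_fun setT (fun w => ((h w j).1 k 0)%:R : R).
  exact: measurableT_comp (m1 j k).
under eq_integral do rewrite intensity_entry.
have msum (C : 'I_q -> 'M[R]_p) (F : T -> nat -> 'I_p -> R) :
   (forall j k, measurable_fun setT (fun w => F w j k)) ->
   measurable_fun setT (fun w => \sum_(k < q) \sum_j C k i j * F w k j).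
  move=> mF; apply: measurable_sum => k; apply: measurable_sum => j.
  exact: measurable_funM.
have isum (C : 'I_q -> 'M[R]_p) (F : T -> nat -> 'I_p -> R) :
   (forall k j, 0 <= C k i j) -> (forall w j k, 0 <= F w j k) ->
   (forall j k, measurable_fun setT (fun w => F w j k)) ->
   (forall j k, \int[P]_w (F w j k)%:E = (x k 0)%:E)%E ->
   (\int[P]_w (\sum_(k < q) \sum_j C k i j * F w k j)%:E =
     (\sum_(k < q) \sum_j C k i j * x j 0)%:E)%E.
  move=> c0 F0 mF eF; under eq_integral do rewrite -sumEFin.
  rewrite ge0_integral_sum//; last 2 first.
  - move=> k; apply/measurable_EFinP; apply: measurable_sum => j.
    exact: measurable_funM.
  - by move=> k w _; rewrite lee_fin sumr_ge0// => j _; rewrite mulr_ge0.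
  rewrite -sumEFin; apply: eq_bigr => k _.
  under eq_integral do rewrite -sumEFin.
  rewrite ge0_integral_sum//; last 2 first.
  - by move=> j; apply/measurable_EFinP; exact: measurable_funM.
  - by move=> j w _; rewrite lee_fin mulr_ge0.
  rewrite -sumEFin; apply: eq_bigr => j _.
  under eq_integral do rewrite EFinM.
  rewrite ge0_integralZl//; [by rewrite eF EFinM| |by move=> w _; rewrite lee_fin|by rewrite lee_fin].
  exact/measurable_EFinP.
have di : 0 <= d i 0 by exact: mxge0E.
have s1 := isum A (fun w j k => (h w j).2 k 0) a0 h0 m2 e2.
have s2 := isum B (fun w j k => ((h w j).1 k 0)%:R) b0 (fun _ _ _ => ler0n _ _) m1' e1.
have p1 w : 0 <= \sum_(k < q) \sum_j A k i j * (h w k).2 j 0.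
  by apply: sumr_ge0 => k _; apply: sumr_ge0 => j _; rewrite mulr_ge0.
have p2 w : 0 <= \sum_(k < q) \sum_j B k i j * ((h w k).1 j 0)%:R.
  by apply: sumr_ge0 => k _; apply: sumr_ge0 => j _; rewrite mulr_ge0.
under eq_integral do rewrite !EFinD.
rewrite ge0_integralD//; last 4 first.
- by move=> w _; rewrite -EFinD lee_fin addr_ge0.
- apply: (eq_measurable_fun (fun w => (d i 0 + \sum_(k < q) \sum_j A k i j * (h w k).2 j 0)%:E)).
    by move=> w _; rewrite EFinD.
  apply/measurable_EFinP; apply: measurable_funD => //.
  exact: (msum A (fun w j k => (h w j).2 k 0)).
- by move=> w _; rewrite lee_fin.
- apply/measurable_EFinP; exact: (msum B (fun w j k => ((h w j).1 k 0)%:R)).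
rewrite ge0_integralD//; last 2 first.
- by move=> w _; rewrite lee_fin.
- apply/measurable_EFinP; exact: (msum A (fun w j k => (h w j).2 k 0)).
rewrite integral_cst// [X in (_ * X + _ + _)%E]probability_setT mule1.
rewrite [X in (_ + X + _)%E]s1 [X in (_ + X)%E]s2 -!EFinD; congr EFin.
rewrite mxE -addrA; congr (_ + _); rewrite /M mulmx_suml summxE -big_split/=.
by apply: eq_bigr => k _; rewrite mulmxDl mxE; congr (_ + _); rewrite mxE.
Qed.

Lemma good_mean (v : 'rV[R]_p) Y lam : subinvariant M 1 v ->
  good_solution P A B d N Y lam -> forall t i,
  (\int[P]_w (lam t w i 0)%:E = ((invmx (1%:M - M) *m d) i 0)%:E)%E.
Proof.
move=> vM [sol st /non_anticipativeP na int].
have [mY ml l0 _ _] := sol.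
pose m : 'cV[R]_p := \col_i fine (\int[P]_w (lam 0 w i 0)%:E).
have mE t i : (\int[P]_w (lam t w i 0)%:E = (m i 0)%:E)%E.
  rewrite (stationary_mean sol st) mxE fineK//.
  have [_ hi] := int 0 i; exact: integrable_fin_num.
pose h t w j : state := (Y (t - j.+1%:Z) w, lam (t - j.+1%:Z) w).
(* Non-anticipation only makes [lam t] measurable for the noise up to time t. This almost surely
   equal version depends on the noise up to t - 1, as [predictable_mean] requires. *)
pose L t w i := intensity A B d (h t w) i 0.
have lag t j : t - j.+1%:Z <= t - 1 by rewrite lerD2l lerN2 -[1]/(1%:Z) lez_nat.
have mL t i : past_measurable N (t - 1) (fun w => L t w i).
  apply: (@measurable_intensity _ _ _ A B d _ (g_sigma_algebraType (past_gen N (t - 1)))).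
  - by move=> j k; apply: past_measurable_mono (lag t j) _; have [] := na (t - j.+1%:Z) k.
  - by move=> j k; apply: past_measurable_mono (lag t j) _; have [] := na (t - j.+1%:Z) k.
have L0 t w i : 0 <= L t w i.
  apply/mxge0E/(mxle_trans d0)/intensity_ge => // j /=.
  by apply/mxge0P => a b; rewrite (ord1 b).
have aeE := solution_intensity sol.
have lL t i : (\int[P]_w (lam t w i 0)%:E = \int[P]_w (L t w i)%:E)%E.
  apply: ge0_ae_eq_integral => //.
  - exact/measurable_EFinP.
  - by apply/measurable_EFinP; apply: (past_measurable_measurable hN); exact: mL.
  - by move=> w _; rewrite lee_fin.
  - by move=> w _; rewrite lee_fin.
  - by apply: filterS aeE => w hw _; have [_ ->] := hw t.
have YL t i : (\int[P]_w ((Y t w i 0)%:R : R)%:E = (m i 0)%:E)%E.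
  rewrite -(mE t) lL -(predictable_mean hN i (mL t i) (fun w => L0 t w i)).
  apply: ge0_ae_eq_integral => //.
  - apply/measurable_EFinP; exact: measurableT_comp (mY t i).
  - have := predictable_measurable hN i (mL t i) (fun w => L0 t w i).
    by move=> hm; apply/measurable_EFinP; exact: measurableT_comp hm.
  - by apply: filterS aeE => w hw _; have [-> {1}->] := hw t.
have mM : m = d + M *m m.
  apply/colP => i; apply: EFin_inj; rewrite -(mE 0) lL.
  apply: integral_intensity => [j k|j k|w j k|j k|j k] /=.
  - exact: mY.
  - exact: ml.
  - exact: l0.
  - exact: YL.
  - exact: mE.
have M0 : mxle 0 M.
  by apply: mxge0_sum => k; have := mxle_add (A0 k) (B0 k); rewrite addr0.
have [u1 _] := subinvariant_unit M0 vM.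
have <- : (1%:M - M) *m m = d by rewrite mulmxBl mul1mx [X in X - _]mM addrK.
by move=> t i; rewrite mulKmx.
Qed.

Variable v : 'rV[R]_p.
Hypothesis vM : subinvariant M 1 v.

Let lamN t w := lam_min A B d (noise_of N w) t.
Let YN t w := Y_min A B d (noise_of N w) t.

Lemma measurable_minimal_noise :
  sigma_gen (fun k f => (Y_min A B d f k.1 k.2 0, lam_min A B d f k.1 k.2 0))
    [set: int * 'I_p] `<=`
  sigma_gen (fun k (f : int * ('I_p * R) -> nat) => f k) [set k | 0 <= k.2.2].
Proof.
pose C0 : set (set (int * ('I_p * R) -> nat)) :=
  \bigcup_(k in [set k : int * ('I_p * R) | 0 <= k.2.2])
    preimage_set_system setT (fun f => f k) measurable.
have mf s i u : 0 <= u ->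
    measurable_fun setT (fun f : g_sigma_algebraType C0 => f (s, (i, u))).
  by move=> u0 _ C mC; apply: sub_sigma_algebra; exists (s, (i, u)) => //; exists C.
apply: smallest_sub; first exact: (@sigma_algebra_measurable _ (g_sigma_algebraType C0)).
move=> E [[t i] _ [C mC <-]].
have hl : measurable_fun setT (fun f : g_sigma_algebraType C0 => lam_min A B d f t i 0).
  by apply: (@measurable_lam_min _ _ _ A B d _ (g_sigma_algebraType C0) id t) => s k u _; exact: mf.
have hY : measurable_fun setT (fun f : g_sigma_algebraType C0 => Y_min A B d f t i 0).
  by apply: (@measurable_Y_min _ _ _ A B d _ (g_sigma_algebraType C0) id t) => s k u _; exact: mf.
exact: (measurable_fun_pair hY hl) measurableT C mC.
Qed.

(** The minimal solution is a measurable function of the noise path that commutes with time shifts,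
    and the law of the noise is shift invariant. *)
Lemma minimal_stationary : stationary P YN lamN.
Proof.
move=> h C hC.
pose D : set (int * ('I_p * R) -> nat) := [set f |
  C (fun k => (Y_min A B d f k.1 k.2 0, lam_min A B d f k.1 k.2 0))].
have hD : sigma_gen (fun k f => f k) [set k | 0 <= k.2.2] D.
  apply: measurable_minimal_noise.
  exact: (sigma_gen_preimage (X := fun k (f : int * ('I_p * R) -> nat) =>
    (Y_min A B d f k.1 k.2 0, lam_min A B d f k.1 k.2 0)) hC).
rewrite -[RHS]/(P [set w | D (fun k => N k.1 k.2.1 k.2.2 w)]).
rewrite (path_law_shift hN h hD); congr (P _); apply/seteqP; split=> w /=.
  rewrite /D /=; under [X in C X -> _]eq_fun do
    rewrite /coords /YN /lamN /= -Y_min_shift -lam_min_shift.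
  by [].
rewrite /D /=; under [X in _ -> C X]eq_fun do
  rewrite /coords /YN /lamN /= -Y_min_shift -lam_min_shift.
by [].
Qed.

Lemma minimal_good : good_solution P A B d N YN lamN.
Proof.
have naN : non_anticipative N YN lamN.
  apply/non_anticipativeP => t i; split; first exact: past_measurable_Y_min.
  have tt : t - 1 <= t by rewrite gerDl.
  by apply: past_measurable_mono tt _; exact: past_measurable_lam_min.
have mY t i : measurable_fun setT (fun w => YN t w i 0).
  by apply: (past_measurable_measurable hN); exact: past_measurable_Y_min.
have ml t i : measurable_fun setT (fun w => lamN t w i 0).
  exact: (measurable_lam_min_process hN).
have ifin := @lam_min_integral_fin _ _ _ P _ _ N hN A B d p0 A0 B0 d0 v vM.
split=> //.
- split=> //.
  + by move=> t w i; exact: lam_min_ge0.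
  + by move=> t; apply: aeW => w; apply/colP => i; rewrite [RHS]mxE; exact: (Y_minE hN).
  + move=> t; apply: filterS (lam_min_equation hN p0 A0 B0 d0 vM) => w hw.
    exact: hw.
- exact: minimal_stationary.
- move=> t i; split; apply/integrableP; split.
  + apply/measurable_EFinP; exact: measurableT_comp (mY t i).
  + under eq_integral do rewrite gee0_abs ?lee_fin//.
    by rewrite (Y_min_integral hN) ifin.
  + exact/measurable_EFinP.
  + under eq_integral do rewrite gee0_abs ?lee_fin ?lam_min_ge0//.
    exact: ifin.
Qed.

Lemma good_unique Y lam : good_solution P A B d N Y lam -> forall t,
  {ae P, forall w, Y t w = YN t w /\ lam t w = lamN t w}.
Proof.
move=> gd t; have [sol st _ int] := gd; have [_ ml l0 _ _] := sol.
have meanE := good_mean vM gd; have meanN := good_mean vM minimal_good.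
have hl : {ae P, forall w, forall i, lamN t w i 0 = lam t w i 0}.
  apply: ae_forall_countable => i; apply: ae_eq_of_le.
  - exact: (measurable_lam_min_process hN).
  - exact: ml.
  - by move=> w; exact: lam_min_ge0.
  - apply: filterS (solution_ge_history hN A0 B0 d0 sol) => w hw.
    rewrite /lamN mxE; apply: lsup_le.
      exact: (history_intensity_nondecreasing hN A0 B0 d0).
    by move=> n; have [_ /(_ i 0)] := hw n t 0%N; rewrite subr0.
  - by rewrite meanE meanN.
  - by rewrite meanE ltry.
apply: filterS2 hl (solution_intensity sol) => w hw /(_ t)[hY _].
have lE : lam t w = lamN t w by apply/colP => i; rewrite -hw.
split=> //; apply/colP => i; rewrite hY lE.
by rewrite /YN (Y_minE hN).
Qed.

Lemma minimal_exp_moments : exists2 delta, 0 < delta & exists K, forall t,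
  (\int[P]_w (expR (delta * \sum_i (YN t w i 0)%:R))%:E <= K%:E)%E /\
  (\int[P]_w (expR (delta * \sum_i lamN t w i 0))%:E <= K%:E)%E.
Proof.
have [dl dl0 [K hK]] := lam_min_exp_moment hN p0 A0 B0 d0 vM.
have [s1 s10 psi_le] := @psi_le_linear R p 1 p0 ltr01.
(* Then psi p e <= 2 e <= dl: the exponential moment of the counts at [e] is bounded by that of the
   intensities at [dl]. *)
pose e := Num.min s1 (dl / 2).
have e0 : 0 < e by rewrite lt_min s10 divr_gt0.
have e1 : e <= s1 by rewrite ge_min lexx.
have e2 : 2 * e <= dl by rewrite mulrC -ler_pdivlMr// ge_min lexx orbT.
have ml t i : measurable_fun setT (fun w => lamN t w i 0).
  exact: (measurable_lam_min_process hN).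
have mexp t a : measurable_fun setT (fun w => (expR (a * \sum_i lamN t w i 0))%:E).
  apply/measurable_EFinP; apply: measurableT_comp => //.
  by apply: measurable_funM => //; exact: measurable_sum.
have slam0 t w : 0 <= \sum_i lamN t w i 0.
  by apply: sumr_ge0 => i _; exact: lam_min_ge0.
exists e => //; exists K => t; split; last first.
  apply: le_trans (hK t); apply: ge0_le_integral => //.
  - exact: mexp.
  by move=> w _; rewrite lee_fin ler_expR ler_wpM2r//; lra.
apply: le_trans (hK t).
apply: (@le_trans _ _ (\int[P]_w (1 * expR (\sum_i lamN t w i 0 * psi p e))%:E)%E).
  have := @predictable_exp_le _ _ _ P _ _ hN t (fun=> 1) (fun i w => lamN t w i 0)
    (fun=> e) p0 _ (fun=> ler01) _ _.
  move=> h; apply: le_trans (h _ _ _).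
  - rewrite le_eqVlt; apply/orP; left; apply/eqP; apply: eq_integral => w _.
    rewrite mul1r mulr_sumr; congr (expR _)%:E; apply: eq_bigr => i _.
    by rewrite /YN (Y_minE hN).
  - exact: measurable_cst.
  - by move=> i; exact: past_measurable_lam_min.
  - by move=> i w; exact: lam_min_ge0.
apply: ge0_le_integral => //.
- under eq_fun do rewrite mul1r -mulr_suml mulrC; exact: mexp.
- exact: mexp.
move=> w _; rewrite lee_fin mul1r ler_expR -mulr_suml mulrC ler_wpM2r//.
by apply: le_trans (psi_le _ (ltW e0) e1) _; lra.
Qed.

End GoodSolutions.

(** Write x = (r / dl) y with y = dl x / r and use ln y <= y; the constant is (r / dl)^r. *)
Lemma powR_le_exp (R : realType) (r dl x : R) : 1 < r -> 0 < dl -> 0 <= x ->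
  x `^ r <= expR (r * ln (r / dl)) * expR (dl * x).
Proof.
move=> r1 dl0 x0; have r0 : 0 < r by apply: lt_trans r1.
have [->|xn0] := eqVneq x 0.
  by rewrite powR0 ?gt_eqF// mulr_ge0 ?expR_ge0.
have xgt0 : 0 < x by rewrite lt_def xn0.
rewrite /powR (negbTE xn0) -expRD ler_expR.
have xE : x = (r / dl) * (x * dl / r) by field; rewrite !gt_eqF.
rewrite [in leLHS]xE lnM ?posrE ?divr_gt0 ?mulr_gt0// mulrDr lerD2l.
have h : ln (x * dl / r) <= x * dl / r.
  have := expR_ge1Dx (ln (x * dl / r)); rewrite lnK ?posrE ?divr_gt0 ?mulr_gt0//; lra.
by apply: le_trans (ler_wpM2l (ltW r0) h) _; rewrite mulrC mulfVK ?gt_eqF// mulrC.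
Qed.

(** * Moments of the good solution *)

Section Moments.
Context {disp : measure_display} {T : measurableType disp} {R : realType}.
Variable P : probability T R.
Context {p q : nat}.
Variable N : int -> 'I_p -> R -> T -> nat.
Hypothesis hN : iid_poisson P N.
Variables (A B : 'I_q -> 'M[R]_p) (d : 'cV[R]_p).
Hypotheses (p0 : (0 < p)%N).
Hypotheses (A0 : forall i, mxle 0 (A i)) (B0 : forall i, mxle 0 (B i)).
Hypothesis d0 : mxle 0 d.
Variable v : 'rV[R]_p.
Hypothesis vM : subinvariant (\sum_(i < q) (A i + B i)) 1 v.
Variables (Y : int -> T -> 'cV[nat]_p) (lam : int -> T -> 'cV[R]_p).
Hypothesis gd : good_solution P A B d N Y lam.

Lemma vnorm1_natcol (y : 'cV[nat]_p) : vnorm1 (natcol y) = \sum_i (y i 0)%:R :> R.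
Proof. by apply: eq_bigr => i _; rewrite mxE normr_nat. Qed.

Lemma measurable_vnorm1_Y t : measurable_fun setT (fun w => vnorm1 (natcol (Y t w)) : R).
Proof.
under eq_fun do rewrite vnorm1_natcol; apply: measurable_sum => i.
by case: gd => -[mY _ _ _ _] _ _ _; exact: measurableT_comp (mY t i).
Qed.

Lemma measurable_vnorm1_lam t : measurable_fun setT (fun w => vnorm1 (lam t w)).
Proof.
apply: measurable_sum => i; case: gd => -[_ ml _ _ _] _ _ _.
exact: measurableT_comp (ml t i).
Qed.

(** Uniqueness transfers the bounds from the minimal solution. *)
Lemma good_exp_moments : exists2 delta, 0 < delta & forall t,
  ('E_P[fun w => expR (delta * vnorm1 (natcol (Y t w)))%R] < +oo)%E /\
  ('E_P[fun w => expR (delta * vnorm1 (lam t w))%R] < +oo)%E.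
Proof.
have [dl dl0 [K hK]] := minimal_exp_moments hN p0 A0 B0 d0 vM.
exists dl => // t; have [hY hl] := hK t.
have gdN := minimal_good hN p0 A0 B0 d0 vM.
have ae := good_unique hN p0 A0 B0 d0 vM gd t.
rewrite !unlock; split.
- apply: le_lt_trans (ltry K); apply: le_trans hY; rewrite le_eqVlt; apply/orP; left.
  apply/eqP; apply: ge0_ae_eq_integral => //.
  + apply/measurable_EFinP; apply: measurableT_comp => //.
    by apply: measurable_funM => //; exact: measurable_vnorm1_Y.
  + apply/measurable_EFinP; apply: measurableT_comp => //; apply: measurable_funM => //.
    apply: measurable_sum => i; case: gdN => -[mY _ _ _ _] _ _ _.
    exact: measurableT_comp (mY t i).
  + by apply: filterS ae => w [-> _] _; rewrite vnorm1_natcol.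
- apply: le_lt_trans (ltry K); apply: le_trans hl; rewrite le_eqVlt; apply/orP; left.
  apply/eqP; apply: ge0_ae_eq_integral => //.
  + apply/measurable_EFinP; apply: measurableT_comp => //.
    by apply: measurable_funM => //; exact: measurable_vnorm1_lam.
  + apply/measurable_EFinP; apply: measurableT_comp => //; apply: measurable_funM => //.
    apply: measurable_sum => i; case: gdN => -[_ ml _ _ _] _ _ _; exact: ml.
  + apply: filterS ae => w [_ ->] _; congr (expR (_ * _))%:E.
    by apply: eq_bigr => i _; rewrite ger0_norm// lam_min_ge0.
Qed.

Lemma good_moments (r : R) t : 1 < r ->
  ('E_P[fun w => (vnorm1 (natcol (Y t w)) `^ r)%R] < +oo)%E.
Proof.
move=> r1; have [dl dl0 /(_ t)[hY _]] := good_exp_moments.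
move: hY; rewrite !unlock => hY.
have n0 w : 0 <= vnorm1 (natcol (Y t w)) :> R by apply: sumr_ge0.
apply: (@le_lt_trans _ _ (\int[P]_w ((expR (r * ln (r / dl)))%:E *
    (expR (dl * vnorm1 (natcol (Y t w))))%:E))%E).
  apply: ge0_le_integral => //=.
  - by move=> w _; rewrite lee_fin powR_ge0.
  - apply/measurable_EFinP; apply: (measurableT_comp (measurable_powR r)).
    exact: measurable_vnorm1_Y.
  - apply/measurable_EFinP; apply: measurable_funM => //; apply: measurableT_comp => //.
    by apply: measurable_funM => //; exact: measurable_vnorm1_Y.
  - by move=> w _; rewrite lee_fin powR_le_exp.
rewrite ge0_integralZl//.
- by rewrite lte_mul_pinfty// lee_fin expR_ge0.
- apply/measurable_EFinP; apply: measurableT_comp => //.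
  by apply: measurable_funM => //; exact: measurable_vnorm1_Y.
Qed.

End Moments.

Theorem theorem4 (R : realType) (disp : measure_display)
    (T : measurableType disp) (P : probability T R) (p q : nat)
    (A B : 'I_q -> 'M[R]_p) (d : 'cV[R]_p)
    (N : int -> 'I_p -> R -> T -> nat)
    (hp : (1 <= p)%N) (hq : (1 <= q)%N)
    (hA : forall i j k, 0 <= A i j k) (hB : forall i j k, 0 <= B i j k)
    (hd : forall i, 0 <= d i 0) (hN : iid_poisson P N) :
  let rho := spectral_radius (\sum_(i < q) (A i + B i)) in
  let good := good_solution P A B d N in
  [/\ rho < 1 ->
      exists Y lam, good Y lam /\
        forall Y' lam', good Y' lam' ->
          forall t, {ae P, forall w, Y' t w = Y t w /\ lam' t w = lam t w},
      (exists Y lam, is_solution P A B d N Y lam /\ stationary P Y lam) ->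
      (forall i, 0 < d i 0) -> rho < 1,
      rho < 1 -> forall Y lam, good Y lam -> forall r : R, 1 < r -> forall t,
        ('E_P[fun w => (vnorm1 (natcol (Y t w)) `^ r)%R] < +oo)%E &
      rho < 1 ->
      \sum_(i < q) (mxnorm1 (A i) + mxnorm1 (B i)) < 1 \/
        mxnormoo (\sum_(i < q) (A i + B i)) < 1 ->
      forall Y lam, good Y lam -> exists2 delta : R, 0 < delta &
        ('E_P[fun w => expR (delta * vnorm1 (natcol (Y 0 w)))%R] < +oo)%E /\
        ('E_P[fun w => expR (delta * vnorm1 (lam 0 w))%R] < +oo)%E].
Proof.
move=> rho good.
have A0 i : mxle 0 (A i) by apply/mxge0P => j k; exact: hA.
have B0 i : mxle 0 (B i) by apply/mxge0P => j k; exact: hB.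
have d0 : mxle 0 d by apply/mxge0P => i j; rewrite (ord1 j).
have M0 : mxle 0 (\sum_(i < q) (A i + B i)).
  by apply: mxge0_sum => k; have := mxle_add (A0 k) (B0 k); rewrite addr0.
have rhoP := spectral_radius_lt1P M0 hp.
split.
- move=> /rhoP[v vM].
  exists (fun t w => Y_min A B d (noise_of N w) t), (fun t w => lam_min A B d (noise_of N w) t).
  split; first exact: (minimal_good hN hp A0 B0 d0 vM).
  by move=> Y' lam' gd t; exact: (good_unique hN hp A0 B0 d0 vM gd t).
- move=> [Y [lam [sol _]]] dgt0; apply: contrapT => rho1.
  have [v [v0 vn0 vM vC]] := superinvariant_exists M0 (fun w sw => rho1 (rhoP.2 (ex_intro _ w sw))).
  apply: (supercritical_no_solution hN hp A0 B0 d0 v0 vM vC _ sol).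
  (* [v] may have zero entries; one nonzero entry and the positivity of all entries of [d] give v d
     > 0. *)
  have [k vk] : exists k, v 0 k != 0.
    apply: contrapT => h; move/eqP: vn0; apply; apply/rowP => k; rewrite mxE.
    by apply/eqP/negPn/negP => vk; apply: h; exists k.
  rewrite row_mul_col (bigD1 k)//= ltr_pwDl//.
    by rewrite mulr_gt0// lt_def vk mxge0E.
  by apply: sumr_ge0 => j _; rewrite mulr_ge0// mxge0E.
- move=> /rhoP[v vM] Y lam gd r r1 t.
  exact: (good_moments hN hp A0 B0 d0 vM gd t r1).
- move=> /rhoP[v vM] _ Y lam gd.
  have [dl dl0 h] := good_exp_moments hN hp A0 B0 d0 vM gd.
  by exists dl => //; exact: h.
Qed.
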